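(* Let $C>1/2$ be a constant, and let $E=E(x)$ be a function with $C\log x\le E$ and $E=o(x/\log^2 x)$. Then \[ \frac{1}{\lfloor E\rfloor^2}\sum_{1\le k\le E}(\lfloor E\rfloor-k)\,\pi_{2k}(x)\ \ge\ \Bigl(1-\frac{1}{2C}\Bigr)\frac{x}{\log^2 x}(1+o(1)), \] where the sum is over integers $k$.
   Context: For an even integer $2k\ge 2$, $\pi_{2k}(x)$ denotes the number of primes $p\le x$ such that $p+2k$ is also prime. For real functions $f,g$, the notation $f(x)\ge g(x)(1+o(1))$ means that for every $\epsilon>0$ we have $f(x)\ge(1-\epsilon)g(x)$ for all sufficiently large $x\ge x_\epsilon$. *)

(* Defs.v *)
From HB Require Import structures.
From mathcomp Require Import all_boot all_order all_algebra.
From mathcomp Require Import all_classical all_reals all_analysis.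

Set Implicit Arguments.
Unset Strict Implicit.
Unset Printing Implicit Defensive.

Import Order.TTheory GRing.Theory Num.Theory.
Import numFieldNormedType.Exports.
Local Open Scope classical_set_scope.
Local Open Scope ring_scope.

(* Required by the notation f =o_+oo g. *)
Canonical pinfty_filterType (R : numFieldType) :=
  FilterType (pinfty_nbhs R) _.

(* pi_h(x); for natural p, p <= x iff p <= Num.truncn x, except when x < 0,
   where Num.truncn x = 0 is not prime. *)
Definition prime_pair_count (R : realType) (h : nat) (x : R) : nat :=
  #|[pred p : 'I_(Num.truncn x).+1 | prime p && prime (p + h)%N]|.

(* f(x) >= g(x) (1 + o(1)) as x -> +oo. *)
Definition asymp_ge (R : realType) (f g : R -> R) : Prop :=
  forall eps : R, 0 < eps -> \forall x \near +oo, f x >= (1 - eps) * g x.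

(* Main.v *)
Require Import Defs.
From HB Require Import structures.
From mathcomp Require Import all_boot all_order all_algebra.
From mathcomp Require Import all_classical all_reals all_analysis.
From mathcomp Require Import zify ring lra.

(** Slide a window of L = floor(E) consecutive odd numbers over [1, x]. A pair of
primes p < p + 2k lies in at most L - k windows, and a window with w primes
contains w(w-1)/2 >= ((2m-1)w - m^2)/2 pairs. With m = 2L/ln x, summing over the
windows gives the theorem, provided pi(x) >= (1 - o(1)) x/ln x.

This half of the Prime Number Theorem is deduced from M(N) = sum_{n <= N} mu(n) =
o(N) by Axer's method. For M(N) = o(N), write m(N) = M(N)/N. By the dual
Turan-Kubilius inequality m(N/p) is close to -m(N) for all primes p outside an
exceptional set with a bounded sum of reciprocals. Elementary bounds on binomial
coefficients yield two non-exceptional primes p < q whose ratio is close to 1 but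
bounded away from it, so m(Nq/p) is close to m(N). Iterating, with m almost
Lipschitz, m is nearly constant on [N, AN] for any fixed A; as sum m(n)/n over that
range is bounded, m(N) is small. *)

Set Implicit Arguments.
Unset Strict Implicit.
Unset Printing Implicit Defensive.

Import Order.TTheory GRing.Theory Num.Theory.
Import numFieldNormedType.Exports.
Local Open Scope classical_set_scope.
Local Open Scope ring_scope.

(** * The Moebius function and its summatory function *)

(** The constant: a window of [L] odd numbers spans length 2L, so it holds about w = 2L/ln x primes,
    and the x/2 windows give about (x/2)(w^2 - w)/2 = (1 - ln x/(2L)) L^2 x/ln^2 x pairs. The term
    -w, which removes the pairing of a prime with itself, is the source of the loss 1/(2C).

    For M(N) = o(N), one prime reverses the sign of m and a pair restores it. The existence of close
    primes must not rest on the prime number theorem. Chebyshev bounds suffice: the excluded primes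
    have a bounded reciprocal sum, while the blocks [2^i, 2^(i+4)) together have a divergent one.
    The lower bound 1 + d' for the ratio depends on d alone, so the number K of steps that cover
    [N, AN] is fixed before the accuracy tau of a step is chosen, of order eps/K. A circle remains:
    exceptional primes depend on the point, and the second point depends on the pair. It is broken
    by excluding at once the exceptional primes of every point of a finite grid. *)

Section Moebius.
Variable R : realType.

(* Since [primes 0 = [::]], the junk value is [moebius 0 = 1]. *)
Definition moebius (n : nat) : R :=
  \prod_(q <- primes n) (- (logn q n == 1)%:R).

Lemma norm_moebius_le1 n : `|moebius n| <= 1.
Proof.
rewrite normr_prod; suff /andP[] : 0 <= \prod_(q <- primes n) `|- (logn q n == 1)%:R : R| <= 1 by [].
apply: (big_ind (fun x => 0 <= x <= 1)) => [|x y /andP[? ?] /andP[? ?]|q _].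
- by rewrite ler01 lexx.
- by apply/andP; split; [exact: mulr_ge0 | exact: mulr_ile1].
- by rewrite normr_ge0 normrN normr_nat lern1 leq_b1.
Qed.

Lemma moebius1 : moebius 1 = 1.
Proof. by rewrite /moebius big_nil. Qed.

Lemma moebius_prime_dvd p j : prime p -> (0 < j)%N -> (p %| j)%N ->
  moebius (p * j) = 0.
Proof.
move=> pp j0 pj; have p0 := prime_gt0 pp.
rewrite /moebius (big_rem p) /=; last first.
  by rewrite mem_primes pp muln_gt0 p0 j0 dvdn_mulr.
have : (0 < logn p j)%N by rewrite logn_gt0 mem_primes pp j0.
by rewrite lognM // (logn_prime _ pp) eqxx; case: (logn p j) => // k _; rewrite oppr0 mul0r.
Qed.

Lemma moebius_prime_ndvd p j : prime p -> ~~ (p %| j)%N ->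
  moebius (p * j) = - moebius j.
Proof.
move=> pp pj; have p0 := prime_gt0 pp.
have j0 : (0 < j)%N by case: j pj => //; rewrite dvdn0.
have perm : perm_eq (primes (p * j)) (p :: primes j).
  apply: uniq_perm => [||q]; rewrite ?primes_uniq //=.
    by rewrite primes_uniq mem_primes pp j0 (negPf pj).
  by rewrite primesM //= primes_prime // !inE.
rewrite /moebius (perm_big _ perm) /= big_cons lognM // (logn_prime _ pp) eqxx.
have -> : logn p j = 0%N by apply/eqP; rewrite -leqn0 leqNgt logn_gt0 mem_primes pp j0.
rewrite mulN1r; congr (- _); apply: eq_big_seq => q qj.
rewrite lognM // (logn_prime _ pp); have [qp|//] := eqVneq q p.
by move: qj; rewrite qp mem_primes (negPf pj) !andbF.
Qed.

Lemma sum_multiples (V : nmodType) (f : nat -> V) (a N : nat) : (0 < a)%N ->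
  \sum_(1 <= k < N.+1 | (a %| k)%N) f k = \sum_(1 <= m < (N %/ a).+1) f (a * m)%N.
Proof.
move=> a0; elim: N => [|N IH]; first by rewrite div0n !big_geq.
rewrite big_mkcond big_nat_recr //= -big_mkcond /= IH divnS //.
case: ifP => aN; last by rewrite add0n addr0.
rewrite [RHS]big_nat_recr //=; congr (_ + f _).
by rewrite -[LHS](divnK aN) divnS // aN mulnC.
Qed.

(** For a prime [p] dividing [n], multiplication by [p] matches the divisors prime to [p] with those
    divisible by [p] exactly once, with opposite signs; multiples of p^2 contribute 0. The common
    bound [N] allows sums over divisors of different [n] to be exchanged. *)
Lemma sum_moebius_divisors (n N : nat) : (0 < n <= N)%N ->
  \sum_(1 <= a < N.+1 | (a %| n)%N) moebius a = (n == 1%N)%:R.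
Proof.
case/andP=> n0 nN.
have -> : \sum_(1 <= a < N.+1 | (a %| n)%N) moebius a =
          \sum_(1 <= a < n.+1 | (a %| n)%N) moebius a.
  rewrite (big_cat_nat (n := n.+1)) //= [X in _ + X]big_nat_cond.
  rewrite [X in _ + X]big1 ?addr0 // => a /andP[/andP[na _]] /(dvdn_leq n0).
  by rewrite leqNgt na.
have [->|n1] := eqVneq n 1%N; first by rewrite big_mkcond big_nat1 dvdnn moebius1.
set p := pdiv n.
have pp : prime p by rewrite pdiv_prime // ltn_neqAle eq_sym n1.
have pn : (p %| n)%N := pdiv_dvd n.
rewrite (bigID (fun a => (p %| a)%N)) /=.
rewrite (eq_bigl (fun a => (p %| a) && (a %| n))%N); last by move=> a; rewrite andbC.
rewrite big_mkcondr sum_multiples ?prime_gt0 // -big_mkcond /=.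
rewrite (bigID (fun a => (p %| a)%N)) /= big_nat_cond big1 ?add0r; last first.
  move=> a /andP[/andP[a0 _]] /andP[_ pa]; exact: moebius_prime_dvd.
rewrite (eq_bigr (fun a => - moebius a)); last first.
  by move=> a /andP[_ pa]; rewrite moebius_prime_ndvd.
rewrite sumrN (_ : \sum_(_ <= _ < _ | _) _ = \sum_(1 <= a < n.+1 | (a %| n)%N && ~~ (p %| a)%N) moebius a) ?addNr //.
rewrite (big_nat_widen _ _ n.+1) ?ltnS ?leq_div //.
rewrite big_nat_cond [RHS]big_nat_cond; apply: eq_bigl => a.
case: (leqP 1 a) => //= a0; case: (ltnP a n.+1) => //= _.
have [pa|pa] /= := boolP (p %| a)%N; first by rewrite andbF andFb andbF.
rewrite Gauss_dvd ?prime_coprime // pn /= !andbT ltnS.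
apply: andb_idr => an; rewrite leq_divRL ?prime_gt0 // mulnC.
by apply: dvdn_leq => //; rewrite Gauss_dvd ?prime_coprime // pn.
Qed.

(** After exchanging the sums, the coefficient of [F k] is the sum of mu(a) over a | k. The choices
    F(k) = 1, N/k and psi(N/k) give the three identities of Axer's method. *)
Lemma moebius_inversion_sum (F : nat -> R) (N : nat) : (0 < N)%N ->
  \sum_(1 <= a < N.+1) moebius a * \sum_(1 <= m < (N %/ a).+1) F (a * m)%N = F 1%N.
Proof.
move=> N0.
under eq_big_nat => a /andP[a0 _].
  rewrite -sum_multiples // mulr_sumr big_mkcond /=; over.
rewrite exchange_big /= big_nat_recl //= [X in _ + X]big_nat [X in _ + X]big1 => [|k /andP[k0 kN]].
  rewrite addr0 -big_mkcond /= -mulr_suml sum_moebius_divisors ?mul1r //.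
rewrite -big_mkcond /= -mulr_suml sum_moebius_divisors //.
by rewrite eqSS gtn_eqF ?mul0r.
Qed.

Definition mertens (n : nat) : R := \sum_(1 <= k < n.+1) moebius k.

Lemma mertens_lip a b : (a <= b)%N -> `|mertens b - mertens a| <= (b - a)%:R.
Proof.
move=> ab; rewrite /mertens (big_cat_nat (n := a.+1)) //= addrAC subrr add0r.
apply: le_trans (ler_norm_sum _ _ _) _.
apply: le_trans (ler_sum _ (fun i _ => norm_moebius_le1 i)) _.
by rewrite sumr_const_nat subSS.
Qed.

Lemma norm_mertens_le n : `|mertens n| <= n%:R.
Proof.
have := @mertens_lip 0 n isT.
by rewrite {2}/mertens big_geq // subr0 subn0.
Qed.

(** Inversion with [F = 1] gives sum mu(k) floor(n/k) = 1. Removing the floors costs at most 1 per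
    term and nothing at k = n, so n times the sum is at most 1 + (n - 1) in absolute value. *)
Lemma norm_sum_moebius_div_le n : `|\sum_(1 <= k < n.+1) moebius k / k%:R| <= 1.
Proof.
case: n => [|n]; first by rewrite big_geq // normr0.
have n0' : 0 < n.+1%:R :> R by rewrite ltr0n.
have := @moebius_inversion_sum (fun=> 1) n.+1 isT.
under eq_big_nat => a _ do rewrite sumr_const_nat subn1 /=.
move=> inv.
have -> : \sum_(1 <= k < n.+2) moebius k / k%:R = n.+1%:R^-1 *
    (1 + \sum_(1 <= k < n.+1) moebius k * (n.+1%:R / k%:R - (n.+1 %/ k)%:R)).
  rewrite -[X in _ = _ * (X + _)]inv [X in _ = _ * (X + _)]big_nat_recr //= divnn /=.
  rewrite [LHS]big_nat_recr //= addrAC -big_split /= mulrDr mulr_sumr mulr1.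
  congr (_ + _); last by rewrite mulrC.
  apply: eq_big_nat => k /andP[k0 _]; have ? : k%:R != 0 :> R by rewrite pnatr_eq0 -lt0n.
  by rewrite -mulrDr addrC subrK mulrCA mulKf ?gt_eqF.
rewrite normrM ger0_norm ?invr_ge0 ?ler0n // ler_pdivrMl // mulr1.
apply: le_trans (ler_normD _ _) _; rewrite normr1 -[leRHS]natr1 addrC lerD2r.
apply: le_trans (ler_norm_sum _ _ _) _.
apply: (@le_trans _ _ (\sum_(1 <= k < n.+1) 1)); last by rewrite sumr_const_nat subn1.
apply: ler_sum_nat => k /andP[k0 kn]; rewrite normrM.
apply: mulr_ile1; rewrite ?norm_moebius_le1 //.
have k0' : 0 < k%:R :> R by rewrite ltr0n.
have -> : n.+1%:R / k%:R - (n.+1 %/ k)%:R = (n.+1 %% k)%:R / k%:R :> R.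
  by rewrite {1}(divn_eq n.+1 k) natrD natrM; field; rewrite gt_eqF.
rewrite ger0_norm ?divr_ge0 ?ler0n // ler_pdivrMr // mul1r ler_nat ltnW //.
by rewrite ltn_mod.
Qed.

End Moebius.

(** * The dual Turan-Kubilius inequality *)

Section TuranKubilius.
Variable R : realType.

(** The centred indicator of divisibility; for distinct primes these functions are almost orthogonal
    on [1, N]. *)
Definition dvd_dev (p n : nat) : R := (p %| n)%:R - p%:R^-1.

Lemma sum_dvdn (p N : nat) : (0 < p)%N ->
  \sum_(1 <= n < N.+1) (p %| n)%:R = (N %/ p)%:R :> R.
Proof.
move=> p0; rewrite (eq_bigr (fun n => if (p %| n)%N then 1 else 0 : R)); last first.
  by move=> n _; case: (p %| n)%N.
by rewrite -big_mkcond sum_multiples // sumr_const_nat subn1.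
Qed.

Lemma divn_bounds (N p : nat) : (0 < p)%N ->
  N%:R / p%:R - 1 < (N %/ p)%:R :> R /\ (N %/ p)%:R <= N%:R / p%:R :> R.
Proof.
move=> p0; have p0' : 0 < p%:R :> R by rewrite ltr0n.
split; last by rewrite ler_pdivlMr // -natrM ler_nat leq_divM.
by rewrite ltrBlDr natr1 ltr_pdivrMr // -natrM ltr_nat ltn_ceil.
Qed.

Lemma sum_dvd_dev (p q N : nat) : (0 < p)%N -> (0 < q)%N ->
  \sum_(1 <= n < N.+1) dvd_dev p n * dvd_dev q n =
  (N %/ lcmn p q)%:R - (N %/ p)%:R / q%:R - (N %/ q)%:R / p%:R + N%:R / (p%:R * q%:R).
Proof.
move=> p0 q0.
rewrite -(sum_dvdn _ p0) -(sum_dvdn _ q0) -sum_dvdn ?lcmn_gt0 ?p0 //.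
have -> : N%:R / (p%:R * q%:R) = \sum_(1 <= n < N.+1) (p%:R^-1 * q%:R^-1) :> R.
  by rewrite sumr_const_nat subn1 /= -invfM -[RHS]mulr_natl.
rewrite !mulr_suml -!sumrB -big_split /=; apply: eq_bigr => n _.
rewrite /dvd_dev dvdn_lcm; case: (p %| n)%N; case: (q %| n)%N => /=; ring.
Qed.

Lemma sum_dvd_dev_diag (p N : nat) : (1 < p)%N ->
  \sum_(1 <= n < N.+1) dvd_dev p n * dvd_dev p n <= N%:R / p%:R.
Proof.
move=> p1; have p0 : (0 < p)%N by exact: ltnW.
rewrite sum_dvd_dev // (lcmn_idPl _) ?dvdnn //.
have [_ c2] := divn_bounds N p0; move: c2; set c := (N %/ p)%:R : R => c2.
have p2 : 2 <= p%:R :> R by rewrite ler_nat.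
have pi0 : 0 < p%:R^-1 :> R by rewrite invr_gt0 ltr0n.
have pi2 : p%:R^-1 <= 2^-1 :> R by rewrite lef_pV2 ?posrE ?ltr0n.
have N0 : 0 <= N%:R :> R by rewrite ler0n.
rewrite invfM; move: c2; set i := p%:R^-1 : R in pi0 pi2 *; move=> c2.
have : c * (1 - 2 * i) <= N%:R * i * (1 - 2 * i) by apply: ler_wpM2r => //; lra.
have : 0 <= N%:R * i * i by rewrite !mulr_ge0 // ltW.
lra.
Qed.

(** Without the floors the four terms of [sum_dvd_dev] cancel, divisibility by coprime numbers being
    independent. Only rounding errors remain, with weights 1, 1/p and 1/q. *)
Lemma sum_dvd_dev_coprime (p q N : nat) : (0 < p)%N -> (0 < q)%N -> coprime p q ->
  `|\sum_(1 <= n < N.+1) dvd_dev p n * dvd_dev q n| <= 2.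
Proof.
move=> p0 q0 pq; rewrite sum_dvd_dev //.
have -> : lcmn p q = (p * q)%N by rewrite -muln_lcm_gcd (eqP pq) muln1.
have [] := divn_bounds N p0; have [] := divn_bounds N q0.
have pq0 : (0 < p * q)%N by rewrite muln_gt0 p0.
have [] := divn_bounds N pq0; rewrite natrM invfM.
have pi1 : p%:R^-1 <= 1 :> R by rewrite invf_le1 ?ler1n ?ltr0n.
have qi1 : q%:R^-1 <= 1 :> R by rewrite invf_le1 ?ler1n ?ltr0n.
have pi0 : 0 < p%:R^-1 :> R by rewrite invr_gt0 ltr0n.
have qi0 : 0 < q%:R^-1 :> R by rewrite invr_gt0 ltr0n.
move: (p%:R^-1 : R) (q%:R^-1 : R) pi1 qi1 pi0 qi0 => i j i1 j1 i0 j0.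
move: ((N %/ (p * q))%:R : R) ((N %/ p)%:R : R) ((N %/ q)%:R : R) (N%:R : R).
move=> c a b n; rewrite mulrA => c1 c2 b1 b2 a1 a2.
have := ler_wpM2r (ltW j0) a2; have := ler_wpM2r (ltW j0) (ltW a1).
have := ler_wpM2r (ltW i0) b2; have := ler_wpM2r (ltW i0) (ltW b1).
by move=> ????; rewrite ler_norml; apply/andP; split; lra.
Qed.

(** In the square norm of [W] the diagonal contributes at most N Q. An off-diagonal covariance is at
    most 2, and by 2|uv| <= u^2 + v^2 these terms add up to at most 2 Q times the sum of the primes;
    the smallness of [P] makes this another N Q. *)
Lemma dual_turan_kubilius (a : nat -> R) (P : seq nat) (N : nat) :
  (0 < N)%N -> uniq P -> all prime P -> (2 * \sum_(p <- P) p <= N)%N ->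
  (forall n, `|a n| <= 1) ->
  \sum_(p <- P) p%:R * (\sum_(1 <= n < N.+1) a n * dvd_dev p n) ^+ 2 <= 2 * N%:R ^+ 2.
Proof.
move=> N0 uP /allP prP PN a1.
set S := fun p => \sum_(1 <= n < N.+1) a n * dvd_dev p n.
rewrite -/(S _); set Q := \sum_(p <- P) _.
pose W n := \sum_(p <- P) p%:R * S p * dvd_dev p n.
have N0' : 0 < N%:R :> R by rewrite ltr0n.
have aW : \sum_(1 <= n < N.+1) a n * W n = Q.
  rewrite /W; under eq_bigr do rewrite mulr_sumr.
  rewrite exchange_big /=; apply: eq_bigr => p _.
  under eq_bigr do rewrite mulrCA.
  by rewrite -mulr_sumr expr2 mulrA.
have Q0 : 0 <= Q by apply: sumr_ge0 => p _; rewrite mulr_ge0 ?sqr_ge0.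
have WW : \sum_(1 <= n < N.+1) W n ^+ 2 <= 2 * N%:R * Q.
  have -> : \sum_(1 <= n < N.+1) W n ^+ 2 = \sum_(p <- P) \sum_(q <- P)
      (p%:R * S p) * (q%:R * S q) * \sum_(1 <= n < N.+1) dvd_dev p n * dvd_dev q n.
    under eq_bigr => n _.
      rewrite expr2 /W mulr_suml; under eq_bigr do rewrite mulr_sumr.
      over.
    rewrite exchange_big /=; apply: eq_bigr => p _.
    rewrite exchange_big /=; apply: eq_bigr => q _.
    by rewrite [RHS]mulr_sumr; apply: eq_bigr => n _; ring.
  apply: (@le_trans _ _ (\sum_(p <- P) \sum_(q <- P)
     ((if q == p then N%:R * (p%:R * S p ^+ 2) else 0) +
      (p%:R * S p ^+ 2 * q%:R + p%:R * (q%:R * S q ^+ 2))))).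
    rewrite big_seq [leRHS]big_seq; apply: ler_sum => p /prP pp.
    rewrite big_seq [leRHS]big_seq; apply: ler_sum => q /prP pq.
    have p0 := prime_gt0 pp; have q0 := prime_gt0 pq.
    have [->|qp] := eqVneq q p.
      apply: (@le_trans _ _ (N%:R * (p%:R * S p ^+ 2))).
        have := sum_dvd_dev_diag N (prime_gt1 pp).
        move/(ler_wpM2l (_ : 0 <= (p%:R * S p) * (p%:R * S p))).
        rewrite -expr2 => /(_ (sqr_ge0 _)) /le_trans; apply.
        by rewrite le_eqVlt; apply/orP; left; apply/eqP; field; rewrite pnatr_eq0 -lt0n.
      have h : 0 <= p%:R * S p ^+ 2 :> R by apply: mulr_ge0 => //; exact: sqr_ge0.
      by rewrite lerDl; apply: addr_ge0; apply: mulr_ge0.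
    have cpq : coprime p q by rewrite prime_coprime // dvdn_prime2 // eq_sym.
    have /(ler_wpM2l (normr_ge0 (p%:R * S p * (q%:R * S q)))) := sum_dvd_dev_coprime N p0 q0 cpq.
    rewrite -normrM => H; apply: le_trans (ler_norm _) _; apply: le_trans H _.
    rewrite add0r !normrM !normr_nat.
    have : 0 <= p%:R * q%:R * (`|S p| - `|S q|) ^+ 2 by rewrite mulr_ge0 ?sqr_ge0 // mulr_ge0.
    by rewrite -[S p ^+ 2]real_normK ?num_real // -[S q ^+ 2]real_normK ?num_real //; nra.
  have -> : \sum_(p <- P) \sum_(q <- P)
     ((if q == p then N%:R * (p%:R * S p ^+ 2) else 0) +
      (p%:R * S p ^+ 2 * q%:R + p%:R * (q%:R * S q ^+ 2))) =
     N%:R * Q + (Q * \sum_(q <- P) q%:R + (\sum_(p <- P) p%:R) * Q).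
    under eq_bigr do rewrite 2!big_split /=.
    rewrite 2!big_split /=; congr (_ + (_ + _)).
    - rewrite mulr_sumr big_seq [RHS]big_seq; apply: eq_bigr => p pP.
      by rewrite -big_mkcond /= -big_filter filter_pred1_uniq // big_seq1.
    - by rewrite mulr_suml; apply: eq_bigr => p _; rewrite mulr_sumr.
    - by rewrite mulr_suml; apply: eq_bigr => p _; rewrite mulr_sumr.
  have : 2 * \sum_(q <- P) q%:R <= N%:R :> R by rewrite -natr_sum -natrM ler_nat.
  by move=> H; have := ler_wpM2r Q0 H; lra.
(* Duality: [Q] is the inner product of [a] and [W], and [WW] bounds the square norm of [W] by a multiple of [Q]; optimise the resulting quadratic inequality. *)
have : 0 <= \sum_(1 <= n < N.+1) (2 * N%:R * a n - W n) ^+ 2.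
  by apply: sumr_ge0 => n _; exact: sqr_ge0.
have -> : \sum_(1 <= n < N.+1) (2 * N%:R * a n - W n) ^+ 2 =
  4 * N%:R ^+ 2 * \sum_(1 <= n < N.+1) (a n ^+ 2) - 4 * N%:R * Q + \sum_(1 <= n < N.+1) W n ^+ 2.
  rewrite -aW !mulr_sumr -sumrB -big_split /=; apply: eq_bigr => n _; ring.
have : \sum_(1 <= n < N.+1) (a n ^+ 2) <= N%:R.
  apply: (@le_trans _ _ (\sum_(1 <= n < N.+1) 1)); last by rewrite sumr_const_nat subn1.
  by apply: ler_sum => n _; rewrite -real_normK ?num_real // expr_le1.
move=> /(ler_wpM2l (_ : 0 <= 4 * N%:R ^+ 2)) => /(_ _) A B.
have {}A := A (mulr_ge0 (ler0n _ 4) (sqr_ge0 _)).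
have : 0 <= 2 * N%:R * (2 * N%:R ^+ 2 - Q) by lra.
by rewrite pmulr_rge0 ?mulr_gt0 // subr_ge0.
Qed.

Local Notation mu := (@moebius R).
Local Notation M := (@mertens R).

Lemma mertens0 : M 0 = 0.
Proof. by rewrite /mertens big_geq. Qed.

Definition mertens_mean (n : nat) : R := M n / n%:R.
Local Notation m := mertens_mean.

Lemma norm_mertens_mean_le1 n : `|m n| <= 1.
Proof.
case: n => [|n]; first by rewrite /m invr0 mulr0 normr0.
by rewrite normrM normfV normr_nat ler_pdivrMr ?ltr0n // mul1r norm_mertens_le.
Qed.

(** In m b - m a = ((M b - M a) - m a (b - a)) / b both parts of the numerator are at most b - a.
    The case [a = 0] is included, as [m 0 = 0] by the convention for division by zero. *)
Lemma mertens_mean_lip a b : (a <= b)%N -> (0 < b)%N ->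
  `|m b - m a| <= 2 * (b%:R - a%:R) / b%:R.
Proof.
move=> ab b0; have b0' : 0 < b%:R :> R by rewrite ltr0n.
have -> : m b - m a = ((M b - M a) - m a * (b%:R - a%:R)) / b%:R.
  rewrite /m; case: (posnP a) => [->|a0].
    by rewrite mertens0 invr0 !mulr0 mul0r !subr0.
  by field; rewrite !pnatr_eq0 -!lt0n a0 b0.
rewrite normrM normfV normr_nat ler_pM2r ?invr_gt0 // mulr_natl mulr2n.
apply: le_trans (ler_normB _ _) _; rewrite -natrB //.
apply: lerD; first exact: mertens_lip.
by rewrite normrM normr_nat ler_piMl // norm_mertens_mean_le1.
Qed.

(** The terms mu(pj) and mu(j) cancel unless p divides j, and there are at most n/p such j. *)
Lemma sum_moebius_multiples (p n : nat) : prime p ->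
  `|\sum_(1 <= j < n.+1) mu (p * j) + M n| <= n%:R / p%:R.
Proof.
move=> pp; have p0 := prime_gt0 pp; rewrite /M -big_split /=.
have [_ H] := divn_bounds n p0; apply: le_trans _ H.
rewrite -sum_dvdn //; apply: le_trans (ler_norm_sum _ _ _) _.
apply: ler_sum_nat => j /andP[j0 _].
case: (boolP (p %| j)%N) => pj.
  by rewrite moebius_prime_dvd // add0r norm_moebius_le1.
by rewrite moebius_prime_ndvd // addNr normr0.
Qed.

(** The error 1/p stems from the multiples of p^2, the error p/N from replacing N/p by its floor. *)
Lemma dvd_dev_mertens_mean (p N : nat) : prime p -> (0 < N)%N ->
  `|p%:R * (\sum_(1 <= n < N.+1) mu n * dvd_dev p n) / N%:R + (m N + m (N %/ p))|
  <= p%:R^-1 + p%:R / N%:R.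
Proof.
move=> pp N0; have p0 := prime_gt0 pp.
have p0' : 0 < p%:R :> R by rewrite ltr0n.
have N0' : 0 < N%:R :> R by rewrite ltr0n.
have [c1 c2] := divn_bounds N p0.
have := sum_moebius_multiples (N %/ p) pp.
have -> : \sum_(1 <= n < N.+1) mu n * dvd_dev p n =
   \sum_(1 <= j < (N %/ p).+1) mu (p * j) - M N / p%:R.
  rewrite -(@sum_multiples R mu) // [X in _ = X - _]big_mkcond /M mulr_suml -sumrB.
  by apply: eq_bigr => n _; rewrite /dvd_dev; case: ifP => _ /=; ring.
set T := \sum_(_ <= _ < _) _; move=> HT.
have -> : p%:R * (T - M N / p%:R) / N%:R + (m N + m (N %/ p)) =
   p%:R / N%:R * (T + M (N %/ p)) + m (N %/ p) * (1 - p%:R / N%:R * (N %/ p)%:R).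
  rewrite /m; case: (posnP (N %/ p)) => [->|n0].
    by rewrite mertens0 !mul0r !addr0; field; rewrite !gt_eqF.
  by field; rewrite !pnatr_eq0 -!lt0n p0 N0 n0.
have c3 : p%:R / N%:R * (N %/ p)%:R <= 1 :> R.
  by rewrite mulrAC ler_pdivrMr // mul1r mulrC -ler_pdivlMr.
have c4 : 1 - p%:R / N%:R * (N %/ p)%:R <= p%:R / N%:R :> R.
  rewrite lerBlDr -[leLHS](@mulfV _ (p%:R / N%:R)); last by rewrite gt_eqF // divr_gt0.
  rewrite -[X in _ <= X + _]mulr1 -mulrDr ler_wpM2l ?divr_ge0 //.
  by rewrite invf_div addrC ltW // -ltrBlDr.
apply: le_trans (ler_normD _ _) _; apply: lerD.
  rewrite normrM ger0_norm ?divr_ge0 //.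
  apply: (@le_trans _ _ (p%:R / N%:R * ((N %/ p)%:R / p%:R))).
    by rewrite ler_wpM2l ?divr_ge0.
  by rewrite mulrA ler_piMl ?invr_ge0.
rewrite normrM [X in _ * X]ger0_norm ?subr_ge0 //.
apply: le_trans c4; rewrite ler_piMl ?subr_ge0 //; exact: norm_mertens_mean_le1.
Qed.

(* As [moebius (p * j) = - moebius j] unless [p] divides [j], the deviation in the Turan-Kubilius inequality is essentially [m N + m (N %/ p)]. *)
Lemma sum_inv_exceptional_primes (P : seq nat) (N : nat) (e : R) :
  0 < e -> (0 < N)%N -> uniq P -> all prime P -> (2 * \sum_(p <- P) p <= N)%N ->
  (forall p, p \in P -> p%:R^-1 + p%:R / N%:R <= e / 2) ->
  (forall p, p \in P -> e < `|m N + m (N %/ p)|) ->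
  \sum_(p <- P) p%:R^-1 <= 8 / e ^+ 2.
Proof.
move=> e0 N0 uP prP PN small bad.
have N0' : 0 < N%:R :> R by rewrite ltr0n.
have := dual_turan_kubilius N0 uP prP PN (@norm_moebius_le1 R).
move=> H; rewrite ler_pdivlMr ?exprn_gt0 // mulr_suml.
(* For an exceptional prime |p S| >= e N / 2, hence p S^2 >= (e N / 2)^2 / p; comparison with 2 N^2
   produces the constant 8. *)
have : \sum_(p <- P) p%:R^-1 * (e ^+ 2) * (N%:R ^+ 2 / 4) <= 2 * N%:R ^+ 2.
  apply: le_trans H; rewrite big_seq [leRHS]big_seq; apply: ler_sum => p pP.
  have pp : prime p by move/allP: prP; apply.
  have p0 : 0 < p%:R :> R by rewrite ltr0n prime_gt0.
  set S := \sum_(_ <= _ < _) _.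
  have h1 : e / 2 * N%:R <= `|p%:R * S|.
    have := dvd_dev_mertens_mean pp N0; rewrite -/S => h2.
    have := le_trans h2 (small _ pP); have := bad _ pP.
    set x := m N + _; set y := p%:R * S / N%:R => h3 h4.
    have : e / 2 <= `|y|.
      have := ler_normB (y + x) y; rewrite addrAC subrr add0r; lra.
    by rewrite /y normrM normfV normr_nat ler_pdivlMr.
  have -> : p%:R * S ^+ 2 = p%:R^-1 * `|p%:R * S| ^+ 2.
    by rewrite real_normK ?num_real //; field; rewrite gt_eqF.
  rewrite -mulrA ler_wpM2l ?invr_ge0 //.
  have -> : e ^+ 2 * (N%:R ^+ 2 / 4) = (e / 2 * N%:R) ^+ 2 by field.
  by rewrite ler_sqr ?nnegrE // mulr_ge0 // divr_ge0 // ltW.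
by rewrite -mulr_suml mulrA ler_pdivrMr // mulrAC ler_pM2r ?exprn_gt0 // -natrM.
Qed.

End TuranKubilius.

(** * Chebyshev bounds and primes in short intervals *)

Section Chebyshev.
Local Open Scope nat_scope.

Lemma uniq_primes_prod_dvd (s : seq nat) (n : nat) :
  uniq s -> all prime s -> all (fun p => p %| n) s -> \prod_(p <- s) p %| n.
Proof.
elim: s => [|p s IH] /=; first by rewrite big_nil dvd1n.
case/andP=> ps us /andP[pp prs] /andP[pn sn]; rewrite big_cons Gauss_dvd ?pn ?IH //.
rewrite big_seq; apply: (big_ind (coprime p)) => [|x y cx cy|q qs]; first exact: coprimen1.
  by rewrite coprimeMr cx.
rewrite prime_coprime // dvdn_prime2 // ?(allP prs) //.
by apply: contraNneq ps => ->.
Qed.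

Lemma prime_ndvd_fact p q : prime p -> q < p -> ~~ (p %| q`!).
Proof.
move=> pp; elim: q => [|q IH] qp.
  by rewrite fact0 dvdn1; apply/negP => /eqP p1; rewrite p1 in pp.
by rewrite factS Euclid_dvdM // negb_or IH ?(ltnW qp) // gtnNdvd.
Qed.

(** A prime in (n - k, n] divides n!, but neither (n - k)! nor k!, because k <= n - k. So the
    product of these primes divides the binomial coefficient. *)
Lemma short_interval_prime_bound (n k : nat) : 2 * k <= n ->
  (n - k) ^ (\sum_((n - k).+1 <= p < n.+1 | prime p) 1) <= 'C(n, k).
Proof.
move=> kn; have kn' : k <= n by lia.
set s := [seq p <- index_iota (n - k).+1 n.+1 | prime p].
have us : uniq s by rewrite filter_uniq ?iota_uniq.
have prs : all prime s by exact: filter_all.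
have rs p : p \in s -> [/\ prime p, n - k < p & p <= n].
  by rewrite mem_filter mem_index_iota ltnS => /andP[-> /andP[-> ->]].
have dvd : all (fun p => p %| 'C(n, k)) s.
  apply/allP => p /rs[pp p1 p2].
  have : p %| 'C(n, k) * (k`! * (n - k)`!).
    by rewrite bin_fact // dvdn_fact // prime_gt0.
  have pk : k < p by lia.
  by rewrite !Euclid_dvdM // (negPf (prime_ndvd_fact pp pk)) (negPf (prime_ndvd_fact pp p1)) !orbF.
have := dvdn_leq _ (uniq_primes_prod_dvd us prs dvd); rewrite bin_gt0 => /(_ kn').
apply: leq_trans; rewrite sum1_count -size_filter -/s.
have {}rs p : p \in s -> n - k <= p by move=> /rs[_ /ltnW].
elim: s rs {us prs dvd} => [|p s IH] rs; first by rewrite big_nil.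
rewrite /= expnS big_cons leq_mul ?rs ?mem_head // IH // => q qs.
by rewrite rs // inE qs orbT.
Qed.

Lemma leq_bin_exp2 n k : 'C(n, k) <= 2 ^ n.
Proof.
case: (leqP k n) => kn; last by rewrite bin_small.
have := Pascal 1 1 n; rewrite addn1 => ->.
rewrite (bigD1 (Ordinal (kn : k < n.+1))) //= !exp1n !muln1.
exact: leq_addr.
Qed.

Lemma mul_bin_central n : n.+1 * 'C(2 * n.+1, n.+1) = 2 * (2 * n).+1 * 'C(2 * n, n).
Proof.
have -> : 2 * n.+1 = (2 * n).+2 by lia.
rewrite -mul_bin_diag /=.
have e : n.+1 * 'C((2 * n).+1, n) = (2 * n).+1 * 'C(2 * n, n).
  have -> : 'C((2 * n).+1, n) = 'C((2 * n).+1, n.+1).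
    by rewrite -[in LHS]bin_sub; [congr 'C(_, _); lia | lia].
  by rewrite -mul_bin_diag.
by rewrite -mulnA -e mulnA; congr (_ * _); lia.
Qed.

Lemma leq_exp4_bin_central n : 0 < n -> 4 ^ n <= 2 * n * 'C(2 * n, n).
Proof.
elim: n => // n IH _; case: (posnP n) => [->|n0] //.
rewrite -mulnA mul_bin_central expnS.
have := IH n0; move: ('C(2 * n, n)) (4 ^ n) => c x; nia.
Qed.

Lemma trunc_log_sum (p x B : nat) : (1 < p) -> (0 < x <= B) ->
  trunc_log p x = \sum_(1 <= j < B.+1) (p ^ j <= x).
Proof.
move=> p1 /andP[x0 xB].
rewrite (big_cat_nat (n := (trunc_log p x).+1)) //=; last first.
  by rewrite ltnS (leq_trans _ xB) // ltnW // (leq_trans (ltn_expl _ p1)) // trunc_logP.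
rewrite [X in (_ + X)]big_nat [X in (_ + X)]big1 ?addn0; last first.
  move=> k /andP[k1 _]; apply/eqP; rewrite eqb0 -ltnNge.
  by apply: leq_trans (trunc_log_ltn x p1) _; rewrite leq_exp2l.
rewrite (eq_big_nat _ _ (F2 := fun=> 1)).
  by rewrite sum_nat_const_nat muln1 subn1.
move=> k /andP[_]; rewrite ltnS => kt.
by rewrite (leq_trans _ (trunc_logP p1 x0)) // leq_exp2l.
Qed.

(** By Legendre's formula the exponent is the sum over k of floor(2n/p^k) - 2 floor(n/p^k). Each
    term is at most 1 and vanishes once p^k > 2n. *)
Lemma pfactor_bin_central p n : prime p -> 0 < n ->
  p ^ logn p 'C(2 * n, n) <= 2 * n.
Proof.
move=> pp n0; have p1 := prime_gt1 pp.
have n2 : 0 < 2 * n by lia.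
apply: leq_trans (trunc_logP p1 n2); rewrite leq_exp2l //.
have E : logn p (2 * n)`! = logn p 'C(2 * n, n) + 2 * logn p n`!.
  have nn : n <= 2 * n by lia.
  rewrite -(bin_fact nn) lognM ?bin_gt0 ?muln_gt0 ?fact_gt0 // lognM ?fact_gt0 //.
  have -> : 2 * n - n = n by lia.
  by rewrite [2 * logn _ _]mul2n -addnn.
have F : logn p n`! = \sum_(1 <= k < (2 * n).+1) n %/ p ^ k.
  rewrite logn_fact // [RHS](big_cat_nat (n := n.+1)) //=; last by lia.
  rewrite [X in _ + X]big_nat [X in _ + X]big1 ?addn0 // => k /andP[k1 _].
  by rewrite divn_small // (leq_trans k1) // ltnW // ltn_expl.
have : logn p (2 * n)`! <= trunc_log p (2 * n) + 2 * logn p n`!.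
  rewrite F logn_fact // big_distrr /=.
  rewrite (@trunc_log_sum p (2 * n) (2 * n)) ?n2 ?leqnn //.
  rewrite -big_split /=; apply: leq_sum => k _.
  case: (leqP (p ^ k) (2 * n)) => tk; last by rewrite divn_small.
  have pk : 0 < p ^ k by rewrite expn_gt0 prime_gt0.
  by rewrite -ltnS ltn_divLR // {1}(divn_eq n (p ^ k)); have := ltn_pmod n pk; nia.
lia.
Qed.

(** Only primes up to 2n occur in the factorisation, and by [pfactor_bin_central] each of their
    powers is at most 2n. *)
Lemma bin_central_le_exp n : 0 < n ->
  'C(2 * n, n) <= (2 * n) ^ (\sum_(0 <= p < (2 * n).+1 | prime p) 1).
Proof.
move=> n0; have c0 : 0 < 'C(2 * n, n) by rewrite bin_gt0; lia.
rewrite {1}(prod_prime_decomp c0) prime_decompE big_map /=.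
apply: (@leq_trans ((2 * n) ^ size (primes 'C(2 * n, n)))).
  have : all prime (primes 'C(2 * n, n)) by exact: all_prime_primes.
  elim: (primes _) => [|p s IH] /=; first by rewrite big_nil.
  by case/andP=> pp /IH H; rewrite big_cons expnS leq_mul // pfactor_bin_central.
rewrite leq_exp2l; last by lia.
rewrite sum1_count -size_filter; apply: uniq_leq_size; first exact: primes_uniq.
move=> p; rewrite mem_primes mem_filter => /and3P[pp _ pC].
rewrite pp mem_index_iota ltnS /= leqNgt; apply/negP => np.
have : p %| (2 * n)`!.
  by rewrite -(@bin_fact (2 * n) n) ?dvdn_mulr //; lia.
by rewrite (negPf (prime_ndvd_fact pp np)).
Qed.

(** The strict bound makes half-open blocks add up; pi(N) is [primes_below N.+1]. *)
Definition primes_below (n : nat) := \sum_(0 <= p < n | prime p) 1.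

(** With 2n = 2^i, compare exponents of 2 in 4^n <= 2n C(2n, n) <= (2n)^(1 + pi(2n)). One unit of
    [.+2] is for the factor 2n, the other for the possible prime 2^i itself. *)
Lemma primes_below_exp2_ge i : 0 < i -> 2 ^ i <= i * (primes_below (2 ^ i)).+2.
Proof.
case: i => // i _; have n0 : 0 < 2 ^ i by rewrite expn_gt0.
have := leq_trans (leq_exp4_bin_central n0) (leq_mul (leqnn _) (bin_central_le_exp n0)).
rewrite -expnS -[4]/(2 ^ 2) -expnM -expnS.
have -> : \sum_(0 <= p < (2 ^ i.+1).+1 | prime p) 1 =
          primes_below (2 ^ i.+1) + prime (2 ^ i.+1).
  by rewrite /primes_below big_mkcond big_nat_recr //= -big_mkcond; case: prime.
rewrite -expnM leq_exp2l // => /leq_trans; apply.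
by rewrite leq_mul2l /=; case: prime; rewrite ?addn1 ?addn0 ltnS.
Qed.

Lemma prime_exp2F i : 1 < i -> prime (2 ^ i) = false.
Proof.
move=> i1; apply/negP => pr; have := dvdn_prime2 (isT : prime 2) pr.
have i2 : 2 < 2 ^ i by rewrite (ltn_exp2l 1 i).
by rewrite dvdn_exp ?(ltnW i1) // ltn_eqF.
Qed.

(* The primes in (2^i, 2^(i+1)] divide the central binomial coefficient. *)
Lemma primes_below_exp2S i : 1 < i ->
  i * primes_below (2 ^ i.+1) <= i * primes_below (2 ^ i) + 2 * 2 ^ i.
Proof.
move=> i1; have := @short_interval_prime_bound (2 ^ i.+1) (2 ^ i).
have -> : 2 ^ i.+1 - 2 ^ i = 2 ^ i by rewrite expnS; lia.
rewrite -expnS leqnn => /(_ isT) /leq_trans /(_ (leq_bin_exp2 _ _)).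
rewrite -expnM leq_exp2l // => H.
have : primes_below (2 ^ i.+1) <= primes_below (2 ^ i) +
     \sum_((2 ^ i).+1 <= p < (2 ^ i.+1).+1 | prime p) 1.
  have i2 : 2 ^ i < 2 ^ i.+1 by rewrite ltn_exp2l.
  rewrite /primes_below (big_cat_nat (n := (2 ^ i).+1)) //=; apply: leq_add.
    by rewrite big_mkcond big_nat_recr //= -big_mkcond prime_exp2F // addn0.
  rewrite [leqRHS](big_cat_nat (n := 2 ^ i.+1)) //=; exact: leq_addr.
move/(leq_mul (leqnn i)); rewrite mulnDr => /leq_trans; apply.
by rewrite leq_add2l.
Qed.

Lemma primes_below_exp2_le i : 3 <= i -> i * primes_below (2 ^ i) <= 4 * 2 ^ i.
Proof.
elim: i => // i IH; rewrite leq_eqVlt => /orP[/eqP <-|].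
  by rewrite /primes_below unlock.
rewrite ltnS => i3; have {}IH := IH i3; have H := primes_below_exp2S (ltnW i3).
have -> : 4 * 2 ^ i.+1 = 8 * 2 ^ i by rewrite expnS; lia.
move: (primes_below (2 ^ i.+1)) (primes_below (2 ^ i)) H IH => b a.
move: (2 ^ i) => x H IH.
(* The hypotheses give i b <= 6x, and 6 (i + 1) / i <= 8 as soon as i >= 3. *)
rewrite -(leq_pmul2l (ltnW (ltnW i3))); nia.
Qed.

(** The Chebyshev constants 1 and 4 are too far apart for a dyadic block, so the block spans four
    doublings. From i = 16 on, i/(i + 4) >= 4/5, and 16 * 4/5 - 4 = 8.8 leaves 8 after the lower
    order terms. *)
Lemma primes_block_ge i : 16 <= i ->
  8 * 2 ^ i <= i * \sum_(2 ^ i <= p < 2 ^ (i + 4) | prime p) 1.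
Proof.
move=> i16; have i4 : 0 < i + 4 by lia.
have i3 : 3 <= i by lia.
have := primes_below_exp2_ge i4; have := primes_below_exp2_le i3.
have -> : primes_below (2 ^ (i + 4)) =
    primes_below (2 ^ i) + \sum_(2 ^ i <= p < 2 ^ (i + 4) | prime p) 1.
  by rewrite -big_cat_nat //= leq_exp2l // leq_addr.
have i2 : 3 * i <= 2 ^ i.
  elim: i i16 {i4 i3} => // i IH; rewrite leq_eqVlt => /orP[/eqP <- //|].
  by rewrite ltnS => h; have := IH h; rewrite expnS; lia.
set c := \sum_(_ <= p < _ | _) 1; rewrite expnD -[2 ^ 4]/16.
move: c (primes_below (2 ^ i)) => c a; move: (2 ^ i) i2 => x i2 H1 H2.
have : 4 * (i + 4) * (a + c).+2 <= 5 * i * (a + c).+2 by rewrite leq_mul //; lia.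
have -> : 5 * i * (a + c).+2 = 5 * (i * a) + 5 * (i * c) + 10 * i by ring.
lia.
Qed.

End Chebyshev.

(** * Prime pairs with ratio close to, but bounded away from, 1 *)

Section PrimePairs.
Variable R : realType.

Lemma ln_ge_half : 1 / 2 <= ln (2 : R).
Proof.
have := @le_ln1Dx R (- (1 / 2)) ltac:(lra).
have -> : 1 - 1 / 2 = 2^-1 :> R by field.
rewrite lnV ?posrE //; lra.
Qed.

Lemma sum_inv_ge_ln (a b : nat) : (0 < a <= b)%N ->
  ln b%:R - ln a%:R <= \sum_(a <= l < b) (l%:R)^-1 :> R.
Proof.
case/andP=> a0; elim: b => [|b IH]; first by rewrite leqNgt a0.
rewrite leq_eqVlt => /orP[/eqP <-|]; first by rewrite big_geq // subrr.
rewrite ltnS => ab; rewrite big_nat_recr //=.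
have b0 : 0 < b%:R :> R by rewrite ltr0n (leq_trans a0).
have : ln (b.+1%:R) - ln b%:R <= b%:R^-1 :> R.
  rewrite -ln_div ?posrE //.
  have -> : b.+1%:R / b%:R = 1 + b%:R^-1 :> R by rewrite -natr1; field; rewrite gt_eqF.
  by apply: le_ln1Dx; rewrite (@lt_trans _ _ 0) ?invr_gt0 //; lra.
by have := IH ab; lra.
Qed.

Lemma sum_inv_le_ln (a b : nat) : (0 < a <= b)%N ->
  \sum_(a <= l < b) (l.+1%:R)^-1 <= ln b%:R - ln a%:R :> R.
Proof.
case/andP=> a0; elim: b => [|b IH]; first by rewrite leqNgt a0.
rewrite leq_eqVlt => /orP[/eqP <-|]; first by rewrite big_geq // subrr.
rewrite ltnS => ab; rewrite big_nat_recr //=.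
have b0 : 0 < b%:R :> R by rewrite ltr0n (leq_trans a0).
have b1 : 0 < b.+1%:R :> R by rewrite ltr0n.
have : ln b%:R - ln b.+1%:R <= - b.+1%:R^-1 :> R.
  rewrite -ln_div ?posrE //.
  have -> : b%:R / b.+1%:R = 1 + - b.+1%:R^-1 :> R.
    by rewrite -natr1; field; rewrite natr1 gt_eqF.
  by apply: le_ln1Dx; rewrite ltrN2 invf_lt1 // ltr1n; lia.
by have := IH ab; move: (b.+1%:R^-1 : R) (ln (b.+1%:R : R)) => u v; lra.
Qed.

Lemma sum_inv_unbounded (a : nat) (W : R) : (0 < a)%N ->
  exists2 b, (a <= b)%N & W <= \sum_(a <= l < b) (l%:R)^-1.
Proof.
move=> a0; pose b := maxn a (Num.truncn (expR (W + ln a%:R))).+1.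
exists b; first exact: leq_maxl.
have ab : (a <= b)%N by exact: leq_maxl.
apply: le_trans (sum_inv_ge_ln _); last by rewrite a0.
rewrite lerBrDr -ler_expR lnK ?posrE ?ltr0n ?(leq_trans a0) //.
apply: le_trans (ltW (truncnS_gt _)) _; rewrite ler_nat; exact: leq_maxr.
Qed.

(** One term of the binomial expansion of (1 + eta)^n is at most the whole. With eta free, the
    logarithm is a small multiple of n whenever k is small against n. *)
Lemma ln_bin_le (n k : nat) (eta : R) : (k <= n)%N -> 0 < eta ->
  ln 'C(n, k)%:R <= eta * n%:R + k%:R * ln eta^-1.
Proof.
move=> kn e0; have C0 : 0 < 'C(n, k)%:R :> R by rewrite ltr0n bin_gt0.
have : 'C(n, k)%:R * eta ^+ k <= (1 + eta) ^+ n.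
  rewrite exprDn (bigD1 (Ordinal (kn : k < n.+1)%N)) //= expr1n mul1r mulr_natl lerDl.
  by apply: sumr_ge0 => i _; rewrite expr1n mul1r mulrn_wge0 // exprn_ge0 // ltW.
rewrite -ler_ln ?posrE ?mulr_gt0 ?exprn_gt0 ?addr_gt0 //.
rewrite lnM ?posrE ?exprn_gt0 // !lnXn ?addr_gt0 //.
have := @le_ln1Dx R eta ltac:(lra) => h.
have : ln (1 + eta) *+ n <= eta * n%:R by rewrite mulr_natr lerMn2r h orbT.
by rewrite lnV ?posrE // mulrN -[ln eta *+ k]mulr_natl; lra.
Qed.

(* The primes in [g, n] divide ['C(n, n - g + 1)], whose logarithm is at most [eta * n + (n - g + 1) * ln (1 / eta)]; take [eta] small, then [d] small. *)
Lemma short_interval_primes_small (s : nat) :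
  exists2 d : R, 0 < d & exists i0 : nat, forall i g n : nat, (i0 <= i)%N ->
    (2 ^ i <= g <= 16 * 2 ^ i)%N -> n%:R <= (1 + d) * g%:R ->
    (4 * 2 ^ s * i * \sum_(g <= p < n.+1 | prime p) 1 < 2 ^ i)%N.
Proof.
pose S : R := 2 ^+ s; have S1 : 1 <= S by rewrite exprn_ege1 // ler1n.
have S0 : 0 < S by lra.
(* The constants in [eta] and [d] make each of the two terms of [ln_bin_le], times [S], at most
   X/64: see [e1] and [e2]. *)
pose eta : R := (64 * 32 * S)^-1; have eta0 : 0 < eta by rewrite invr_gt0; lra.
pose L := ln eta^-1; have L0 : 0 <= L by rewrite ln_ge0 // invrK; lra.
have LS : L <= 64 * 32 * S by rewrite /L /eta invrK; apply/ltW/ln_sublinear; lra.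
pose d : R := ((34 * 32) * (64 * 32) * S ^+ 2)^-1.
have SS : 1 <= S ^+ 2 by rewrite exprn_ege1.
have d0 : 0 < d by rewrite invr_gt0; lra.
have d1 : d <= (34 * 32)^-1 by rewrite lef_pV2 ?posrE //; lra.
exists d => //; exists (maxn 4 (Num.truncn d^-1).+1) => i g n.
rewrite geq_max => /andP[i4 id] /andP[g1 g2] ng.
case: (ltnP n g) => [ng'|gn]; first by rewrite big_geq // muln0 expn_gt0.
pose X : R := 2 ^+ i; have X0 : 0 < X by rewrite exprn_gt0.
have gX : X <= g%:R by rewrite /X -natrX ler_nat.
have gX2 : g%:R <= 16 * X by rewrite /X -natrX -natrM ler_nat.
have dX : 1 <= d * X.
  rewrite -ler_pdivrMl // mulr1; apply: le_trans (ltW (truncnS_gt _)) _.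
  rewrite /X -natrX ler_nat; apply: leq_trans id _; exact/ltnW/ltn_expl.
have g0 : (0 < g)%N by rewrite (leq_trans _ g1) // expn_gt0.
pose k := (n - g.-1)%N.
have kE : k%:R = n%:R - g%:R + 1 :> R.
  have gE : g%:R = g.-1%:R + 1 :> R by rewrite natr1 prednK.
  by rewrite /k natrB ?(leq_trans (leq_pred _) gn) // gE; ring.
have kd : k%:R <= 17 * (d * X).
  have : d * g%:R <= d * (16 * X) by rewrite ler_pM2l.
  lra.
have dX2 : d * X <= (34 * 32)^-1 * X by rewrite ler_pM2r.
have kn : (2 * k <= n)%N.
  rewrite -(ler_nat R) natrM; have : g%:R <= n%:R :> R by rewrite ler_nat.
  lra.
have := short_interval_prime_bound kn.
have -> : (n - k)%N = g.-1 by rewrite /k subKn // (leq_trans (leq_pred _) gn).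
rewrite prednK //; set c := (\sum_(g <= p < n.+1 | prime p) 1)%N => H.
have gi : (2 ^ i.-1 <= g.-1)%N.
  move: g1; rewrite -{1}(prednK (ltnW (ltnW (ltnW i4)))) expnS.
  have : (0 < 2 ^ i.-1)%N by rewrite expn_gt0.
  by clear; lia.
have kn1 : (k <= n)%N by exact: leq_subr.
have C0 : 0 < 'C(n, k)%:R :> R by rewrite ltr0n bin_gt0.
have : ((2 ^ i.-1) ^ c)%:R <= 'C(n, k)%:R :> R.
  by rewrite ler_nat (leq_trans _ H) //; case: (c) => // c'; rewrite leq_exp2r.
rewrite -ler_ln ?posrE // ?ltr0n ?expn_gt0 // => /le_trans /(_ (ln_bin_le kn1 eta0)).
rewrite -expnM natrX lnXn // -/L -[ln 2 *+ _]mulr_natl natrM.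
have -> : i.-1%:R = i%:R - 1 :> R.
  by rewrite -[X in _ = X%:R - 1](prednK (ltnW (ltnW (ltnW i4)))) -natr1 addrK.
have i4' : 4 <= i%:R :> R by rewrite ler_nat.
have c0 : 0 <= c%:R :> R by [].
have lnh := ln_ge_half.
move=> main.
have h1 : i%:R * c%:R / 4 <= (i%:R - 1) * c%:R * ln (2 : R).
  have : (i%:R - 1) * c%:R * (1 / 2) <= (i%:R - 1) * c%:R * ln (2 : R).
    by rewrite ler_wpM2l // mulr_ge0 //; lra.
  have : 4 * c%:R <= i%:R * c%:R :> R by rewrite ler_wpM2r.
  lra.
have h2 : k%:R * L <= 17 * (d * X) * (64 * 32 * S).
  by apply: ler_pM.
have h3 : eta * n%:R <= eta * (32 * X).
  rewrite ler_pM2l // ; apply: le_trans ng _; have : d * g%:R <= 1 * g%:R.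
    by rewrite ler_wpM2r //; lra.
  lra.
have e1 : S * (eta * (32 * X)) = X / 64 by rewrite /eta; field; rewrite gt_eqF.
have e2 : S * (17 * (d * X) * (64 * 32 * S)) = X / 64 by rewrite /d; field; rewrite gt_eqF.
have : S * (i%:R * c%:R / 4) <= X / 64 + X / 64.
  by rewrite -{1}e1 -e2 -mulrDr ler_pM2l //; lra.
move=> fin; rewrite -(ltr_nat R) !natrM !natrX -/S -/X; lra.
Qed.

Lemma sum_nat_concat (V : nmodType) (f : nat -> nat) (P : pred nat) (F : nat -> V) (a b : nat) :
  (forall t, f t <= f t.+1)%N -> (a <= b)%N ->
  \sum_(a <= t < b) \sum_(f t <= p < f t.+1 | P p) F p = \sum_(f a <= p < f b | P p) F p.
Proof.
move=> fS; elim: b => [|b IH]; first by rewrite leqn0 => /eqP ->; rewrite !big_geq.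
rewrite leq_eqVlt => /orP[/eqP <-|]; first by rewrite !big_geq.
rewrite ltnS => ab; rewrite big_nat_recr //= IH // -big_cat_nat //=.
exact: (homo_leq leqnn (fun _ _ _ => @leq_trans _ _ _) fS).
Qed.

(* Some block [2^i, 2^(i+4)) has few exceptional primes because the harmonic series diverges. Cut it into cells of relative length at most [d]: a cell with many remaining primes cannot have all of them within a factor [1 + d'] of the least one. *)
Lemma nonexceptional_prime_pair (d : R) : 0 < d ->
  exists2 d' : R, 0 < d' & forall (p0 : nat) (W : R), exists Y : nat, forall X : pred nat,
    \sum_(p0 <= p < Y | prime p && X p) (p%:R)^-1 <= W ->
    exists p q : nat, [/\ prime p, prime q, ~~ X p & ~~ X q] /\
      [/\ (p0 <= p < Y)%N, (p0 <= q < Y)%N,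
         (1 + d') * p%:R <= q%:R & q%:R <= (1 + d) * p%:R].
Proof.
move=> d0; pose s := Num.truncn d^-1.
have ds : (2 ^+ s.+1)^-1 <= d.
  rewrite -[leRHS]invrK lef_pV2 ?posrE ?exprn_gt0 ?invr_gt0 //.
  apply: le_trans (ltW (truncnS_gt _)) _.
  by rewrite -natrX ler_nat; exact/ltnW/ltn_expl.
have [d' d'0 [i0 small]] := short_interval_primes_small s.+1.
move: small ds; set s' := s.+1 => small ds.
exists d' => // p0 W.
pose l0 := (i0 + p0 + s' + 16)%N; have l00 : (0 < l0)%N by rewrite /l0; lia.
have [L l0L HL] := sum_inv_unbounded (16 * W + 16) l00.
exists (2 ^ (4 * L))%N => X HX.
pose f l := (2 ^ (4 * l))%N.
have fS l : (f l <= f l.+1)%N by rewrite leq_exp2l //; lia.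
(* Otherwise these blocks alone would carry a reciprocal sum of at least (16 W + 16)/16 > W. *)
have [l /andP[ll0 lL] Hl] : exists2 l, (l0 <= l < L)%N &
    \sum_(f l <= p < f l.+1 | prime p && X p) (p%:R)^-1 < (16 * l%:R)^-1 :> R.
  apply: contrapT => H.
  have : \sum_(l0 <= l < L) (16 * l%:R)^-1 <=
      \sum_(l0 <= l < L) \sum_(f l <= p < f l.+1 | prime p && X p) (p%:R)^-1 :> R.
    apply: ler_sum_nat => l lL; rewrite leNgt; apply/negP => Hl; apply: H.
    by exists l.
  rewrite sum_nat_concat //.
  have -> : \sum_(l0 <= l < L) (16 * l%:R)^-1 = 16^-1 * \sum_(l0 <= l < L) (l%:R)^-1 :> R.
    by rewrite mulr_sumr; apply: eq_bigr => l _; rewrite invfM.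
  have : \sum_(f l0 <= p < f L | prime p && X p) (p%:R)^-1 <= W :> R.
    apply: le_trans HX; rewrite [leRHS](big_cat_nat (n := f l0)) //=.
    - by rewrite lerDr; apply: sumr_ge0 => p _; rewrite invr_ge0.
    - by apply: (@leq_trans l0); [rewrite /l0; lia | rewrite /f; apply/ltnW/(leq_trans (ltn_expl l0 (isT : 1 < 2)%N)); rewrite leq_exp2l //; lia].
    - by rewrite leq_exp2l //; lia.
  lra.
pose i := (4 * l)%N.
have i0i : (i0 <= i)%N by rewrite /i; move: ll0; rewrite /l0; lia.
have p0i : (p0 <= 2 ^ i)%N.
  by apply: leq_trans (ltnW (ltn_expl i (isT : 1 < 2)%N)); rewrite /i; move: ll0; rewrite /l0; lia.
have si : (s' <= i)%N by rewrite /i; move: ll0; rewrite /l0; lia.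
have i16 : (16 <= i)%N by rewrite /i; move: ll0; rewrite /l0; lia.
have iL : (2 ^ (i + 4) <= 2 ^ (4 * L))%N by rewrite leq_exp2l // /i; lia.
have fl1 : f l.+1 = (2 ^ (i + 4))%N by rewrite /f /i; congr expn; lia.
rewrite fl1 -/(f l) in Hl.
have X16 : (2 ^ (i + 4) = 16 * 2 ^ i)%N by rewrite expnD mulnC.
set nb := (\sum_(2 ^ i <= p < 2 ^ (i + 4) | prime p && X p) 1)%N.
(* Each exceptional prime of the block has reciprocal at least 1/(16 * 2^i), and i = 4l. So they are
   fewer than half of the 8 * 2^i / i primes that the block is known to contain. *)
have nbl : (i * nb < 4 * 2 ^ i)%N.
  have x0 : 0 < (16 * 2 ^ i)%:R :> R by rewrite ltr0n muln_gt0 expn_gt0.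
  have l0' : 0 < l%:R :> R by rewrite ltr0n; lia.
  have : nb%:R / (16 * 2 ^ i)%:R < (16 * l%:R)^-1 :> R.
    apply: le_lt_trans Hl; rewrite /nb natr_sum mulr_suml big_nat_cond [leRHS]big_nat_cond.
    apply: ler_sum => p /andP[/andP[p1 p2] /andP[pp _]].
    by rewrite mul1r lef_pV2 ?posrE // ?ltr0n ?prime_gt0 // ler_nat -X16 ltnW.
  rewrite ltr_pdivrMr // mulrC ltr_pdivlMr ?mulr_gt0 // -!natrM ltr_nat /i.
  lia.
set ng := (\sum_(2 ^ i <= p < 2 ^ (i + 4) | prime p && ~~ X p) 1)%N.
have ngl : (4 * 2 ^ i < i * ng)%N.
  have := primes_block_ge i16; rewrite (bigID X) /= -/nb -/ng mulnDr; lia.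
pose ell := (2 ^ (i - s'))%N.
have ell0 : (0 < ell)%N by rewrite expn_gt0.
have ellE : (2 ^ s' * ell = 2 ^ i)%N by rewrite -expnD subnKC.
pose g t := (t * ell)%N.
have gS t : (g t <= g t.+1)%N by rewrite leq_mul2r leqnSn orbT.
pose cell t := (\sum_(g t <= p < g t.+1 | prime p && ~~ X p) 1)%N.
have sc : (2 ^ s' <= 16 * 2 ^ s')%N by lia.
have cellE : ng = (\sum_(2 ^ s' <= t < 16 * 2 ^ s') cell t)%N.
  by rewrite /cell sum_nat_concat // /g -mulnA ellE -X16.
(* Pigeonhole over 15 * 2^s' cells: otherwise the total would be at most (15/4) 2^i / i,
   contradicting [ngl]. *)
have [t /andP[t1 t2] Ht] : exists2 t, (2 ^ s' <= t < 16 * 2 ^ s')%N &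
    (2 ^ i <= 4 * 2 ^ s' * i * cell t)%N.
  apply: contrapT => H.
  have : (4 * 2 ^ s' * i * ng <= (16 * 2 ^ s' - 2 ^ s') * 2 ^ i)%N.
    rewrite cellE big_distrr /= -sum_nat_const_nat big_nat_cond [leqRHS]big_nat_cond.
    apply: leq_sum => t /andP[ht _].
    by rewrite leqNgt; apply/negP => H'; apply: H; exists t => //; exact: ltnW.
  have : (4 * 2 ^ s' * (4 * 2 ^ i) < 4 * 2 ^ s' * (i * ng))%N.
    by rewrite ltn_pmul2l ?muln_gt0 ?expn_gt0.
  have := leq_mul2r (2 ^ i) (16 * 2 ^ s' - 2 ^ s') (16 * 2 ^ s').
  rewrite leq_subr orbT; lia.
pose good p := [&& (g t <= p < g t.+1)%N, prime p & ~~ X p].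
have [p0' p0'g] : exists p, good p.
  apply: contrapT => H; move: Ht; rewrite /cell big_nat_cond big1.
    by rewrite muln0 leqn0 expn_eq0.
  by move=> p ?; exfalso; apply: H; exists p; rewrite /good.
case: (ex_minnP (ex_intro _ p0' p0'g)) => p /and3P[/andP[p1 p2] pp Xp] pmin.
have pge : (2 ^ i <= p)%N by rewrite -ellE (leq_trans _ p1) // leq_mul2r t1 orbT.
have qle q : (q < g t.+1)%N -> (q < 2 ^ (i + 4))%N.
  by move=> /leq_trans; apply; rewrite X16 -ellE mulnA leq_mul2r t2 orbT.
have [q /and3P[/andP[q1 q2] pq Xq] Hq] : exists2 q, good q & (1 + d') * p%:R <= q%:R.
  apply: contrapT => H; pose n := Num.truncn ((1 + d') * p%:R).
  have H0 : 0 <= (1 + d') * p%:R :> R by rewrite mulr_ge0 // addr_ge0 // ltW.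
  have /andP[n1 _] := truncn_itv H0; rewrite -/n in n1.
  have := small i p n i0i; rewrite pge -X16 (ltnW (qle _ p2)) n1 => /(_ isT isT).
  apply/negP; rewrite -leqNgt; apply: leq_trans Ht _.
  rewrite leq_mul2l; apply/orP; right; rewrite /cell !sum1_count -!size_filter.
  apply: uniq_leq_size => [|q]; first by rewrite filter_uniq // iota_uniq.
  rewrite !mem_filter !mem_index_iota => /andP[/andP[pq Xq] qI]; rewrite pq /=.
  have gq : good q by rewrite /good qI pq.
  rewrite pmin //= ltnS leqNgt; apply/negP => nq; apply: H; exists q => //.
  apply: ltW; apply: lt_le_trans (truncnS_gt _) _; by rewrite ler_nat.
exists p, q; split; first by split.
have q3 : (2 ^ i <= q)%N by rewrite -ellE (leq_trans _ q1) // leq_mul2r t1 orbT.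
split => //.
- by rewrite (leq_trans p0i) //= (leq_trans _ iL) // qle.
- by rewrite (leq_trans p0i) //= (leq_trans _ iL) // qle.
rewrite mulrDl mul1r -lerBlDl; apply: (@le_trans _ _ ((2 ^+ s')^-1 * p%:R)); last first.
  by rewrite ler_wpM2r.
rewrite ler_pdivlMl ?exprn_gt0 //.
have : (q <= p + ell)%N.
  by rewrite addnC; apply/ltnW/(leq_trans q2); rewrite /g mulSn leq_add2l.
rewrite -(ler_nat R) natrD -lerBlDl => H.
have : (2 ^+ s') * (q%:R - p%:R) <= (2 ^+ s') * ell%:R :> R by rewrite ler_pM2l ?exprn_gt0.
move/le_trans; apply; by rewrite -natrX -natrM ler_nat ellE.
Qed.

End PrimePairs.

(** * M(N) = o(N) *)

Section MertensLittleo.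
Variable R : realType.
Local Notation mu := (@moebius R).
Local Notation M := (@mertens R).
Local Notation m := (@mertens_mean R).

Lemma sum_has_le (r : seq nat) (s : seq nat) (P : pred nat) (Q : nat -> pred nat) (F : nat -> R) :
  (forall n, 0 <= F n) ->
  \sum_(n <- r | P n && has (fun j => Q j n) s) F n <=
  \sum_(j <- s) \sum_(n <- r | P n && Q j n) F n.
Proof.
move=> F0; elim: s => [|j s IH].
  by rewrite big_nil big1 // => n; rewrite andbF.
rewrite big_cons; apply: le_trans (lerD (lexx _) IH).
rewrite big_mkcond [X in _ <= X + _]big_mkcond [X in _ <= _ + X]big_mkcond -big_split /=.
apply: ler_sum => n _; have Fn := F0 n.
by case: (P n); case: (Q j n); case: (has _ s) => /=; lra.
Qed.

(** With z = N/p, the last two hypotheses place N'/q between z - z/k - 1 and z. Since z >= 4k, the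
    rounding is harmless and [mertens_mean_lip] applies. *)
Lemma mertens_mean_ratio (N q p N' : nat) (k : R) :
  (0 < p <= q)%N -> 4 <= k -> 4 * k * p%:R <= N%:R ->
  (N' * p <= N * q)%N -> (N * q)%:R <= ((N'%:R + N%:R / k + 1) * p%:R : R) ->
  `|m (N %/ p) - m (N' %/ q)| <= 4 / k.
Proof.
move=> /andP[p0 pq] k4 Nk up low; have q0 : (0 < q)%N by exact: leq_trans pq.
have p0' : 0 < p%:R :> R by rewrite ltr0n.
have q0' : 0 < q%:R :> R by rewrite ltr0n.
have pq' : p%:R <= q%:R :> R by rewrite ler_nat.
have k0 : 0 < k by lra.
have ab : (N' %/ q <= N %/ p)%N.
  rewrite leq_divRL // -(leq_pmul2r q0) mulnAC; apply: leq_trans up.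
  by rewrite leq_mul2r leq_divM orbT.
have [b1 b2] := divn_bounds R N p0; have [a1 a2] := divn_bounds R N' q0.
pose z := N%:R / p%:R : R; have z4 : 4 * k <= z by rewrite /z ler_pdivlMr.
rewrite -/z in b1 b2.
pose y := z / k; have y4 : 4 <= y by rewrite /y ler_pdivlMr.
have yk : y * k = z by rewrite /y divfK // gt_eqF.
have h : z <= N'%:R / q%:R + y + 1.
  have e1 : N%:R / k = y * p%:R by rewrite /y /z; field; rewrite !gt_eqF.
  have e2 : (N * q)%:R = z * p%:R * q%:R :> R by rewrite natrM /z divfK // gt_eqF.
  have : z * p%:R * q%:R <= (N'%:R / q%:R + y + 1) * p%:R * q%:R.
    rewrite -e2; apply: le_trans low _; rewrite mulrAC ler_pM2r // e1 !mulrDl divfK ?gt_eqF // mul1r.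
    apply: lerD; last by rewrite ler1n.
    by rewrite lerD2l ler_pM2l //; lra.
  by rewrite ler_pM2r // ler_pM2r.
have b0 : (0 < N %/ p)%N by rewrite -(ltr_nat R); lra.
have b0' : 0 < (N %/ p)%:R :> R by rewrite ltr0n.
apply: le_trans (mertens_mean_lip R ab b0) _.
rewrite ler_pdivrMr // mulrAC ler_pdivlMr //.
have : ((N %/ p)%:R - (N' %/ q)%:R) * k <= (2 + y) * k by rewrite ler_pM2r //; lra.
lra.
Qed.

(* If [p < q] are not exceptional for [N] and for the point [N'] near [N * q / p] of a fine arithmetic grid, then [m N], [- m (N %/ p)], [- m (N' %/ q)] and [m N'] are all close. *)
Lemma mertens_mean_step (d : R) : 0 < d -> d <= 1 ->
  exists2 d' : R, 0 < d' & forall tau : R, 0 < tau -> exists N0 : nat,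
    forall N, (N0 <= N)%N -> exists N' : nat,
      [/\ (1 + d') * N%:R <= N'%:R, N'%:R <= (1 + d) * N%:R & `|m N' - m N| <= tau].
Proof.
move=> d0 d1; have [d2 d20 pairs] := nonexceptional_prime_pair d0.
exists (d2 / 2); first by rewrite divr_gt0.
move=> tau tau0; pose e := tau / 4; have e0 : 0 < e by rewrite divr_gt0.
have eE : e = tau / 4 by [].
clearbody e.
(* The bound k >= 8/tau makes the passage from N/p to N'/q cost at most tau/2, the rest of tau being
   2e. The bound k >= 4/d2 makes rounding to the grid cost at most N d2/4. *)
pose k := ((Num.truncn (4 / d2 + 8 / tau)).+1 + 3)%N.
have kb : 4 / d2 + 8 / tau + 3 <= k%:R.
  have := truncnS_gt (4 / d2 + 8 / tau); by rewrite /k natrD lerD2r => /ltW.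
have h1 : 0 < 4 / d2 by rewrite divr_gt0.
have h2 : 0 < 8 / tau by rewrite divr_gt0.
have k4 : 4 <= k%:R :> R by rewrite ler_nat /k addnC.
have k0 : 0 < k%:R :> R by lra.
have kn0 : (0 < k)%N by rewrite -(ltr0n R).
clearbody k.
(* Primes above 4/e keep 1/p below e/4; the weight allows 8/e^2 for each of the 2k + 1 grid
   points. *)
have [Y HY] := pairs (Num.truncn (4 / e)).+1 ((2 * k).+1%:R * (8 / e ^+ 2)).
have Ye : 0 <= 4 * Y%:R / e by apply: divr_ge0; [exact: mulr_ge0 | exact: ltW].
(* In order: for the sum of the primes below Y, for [mertens_mean_ratio], for [Dk], for p/N <= e/4,
   and for the rounding of N q/p. *)
exists (2 * (Y * Y) + 4 * k * Y + 2 * k + (Num.truncn (4 * Y%:R / e)).+1 +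
        (Num.truncn (4 / d2)).+1)%N => N NN.
have N1 : 2 * (Y%:R * Y%:R) + 4 * k%:R * Y%:R + 2 * k%:R + 4 * Y%:R / e + 4 / d2 <= N%:R.
  apply: le_trans (_ : _ <= _%:R) _; last by rewrite ler_nat; exact: NN.
  rewrite !natrD !natrM; have := truncnS_gt (4 * Y%:R / e); have := truncnS_gt (4 / d2).
  lra.
have Yk0 : 0 <= 4 * k%:R * Y%:R :> R by apply: mulr_ge0 => //; lra.
have YY0 : 0 <= 2 * (Y%:R * Y%:R) :> R by apply: mulr_ge0 => //; exact: mulr_ge0.
have N0 : 0 < N%:R :> R by lra.
have N0' : (0 < N)%N by rewrite -(ltr0n R).
pose D := (N %/ k)%N; have [D1 D2] := divn_bounds R N kn0; rewrite -/D in D1 D2.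
have Dk : N%:R <= (2 * k)%:R * D%:R :> R.
  have : (N%:R / k%:R - 1) * k%:R <= D%:R * k%:R :> R by rewrite ler_pM2r // ltW.
  by rewrite mulrBl divfK ?gt_eqF // natrM; lra.
(* All candidates for the second point are fixed before the pair is known. By [Dk] they reach 2N >=
   (1 + d) N. *)
pose x j := (N + j * D)%N.
pose bad j p := e < `|m (x j) + m (x j %/ p)|.
have [] := HY (fun p => has (fun j => bad j p) (iota 0 (2 * k).+1)).
  apply: le_trans (@sum_has_le _ _ _ _ _ _) _; first by move=> n; rewrite invr_ge0.
  apply: (@le_trans _ _ (\sum_(j <- iota 0 (2 * k).+1) (8 / e ^+ 2))); last first.
    by rewrite big_const_seq count_predT size_iota iter_addr_0 [leRHS]mulr_natl.
  apply: ler_sum => j _; rewrite -big_filter.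
  set P := [seq _ <- _ | _].
  have inP p : p \in P -> [/\ prime p, bad j p, 4 / e <= p%:R & (p <= Y)%N].
    rewrite mem_filter mem_index_iota => /andP[/andP[-> ->] /andP[p1 p2]]; split=> //.
      by apply: le_trans (ltW (truncnS_gt _)) _; rewrite ler_nat.
    exact: ltnW.
  have uP : uniq P by rewrite filter_uniq // iota_uniq.
  have xN : (N <= x j)%N by exact: leq_addr.
  have xN' : N%:R <= (x j)%:R :> R by rewrite ler_nat.
  apply: (@sum_inv_exceptional_primes R P (x j)) => //.
  - exact: leq_trans N0' xN.
  - by apply/allP => p /inP[].
  - apply: leq_trans xN; rewrite -(ler_nat R) natrM.
    apply: (@le_trans _ _ (2 * (Y%:R * Y%:R))); last by lra.
    rewrite ler_pM2l // -natrM ler_nat.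
    apply: (@leq_trans (\sum_(p <- P) Y)%N).
      by rewrite big_seq [leqRHS]big_seq; apply: leq_sum => p /inP[].
    rewrite big_const_seq count_predT iter_addn_0 leq_mul2l; apply/orP; right.
    have -> : Y = size (iota 0 Y) by rewrite size_iota.
    apply: uniq_leq_size => // p; rewrite mem_filter mem_index_iota mem_iota.
    by move=> /andP[_ /andP[_]].
  - move=> p /inP[pp _ p1 p2]; have p0 : 0 < p%:R :> R by rewrite ltr0n prime_gt0.
    have : p%:R^-1 <= e / 4 by rewrite -[leRHS]invrK lef_pV2 ?posrE ?invr_gt0 ?divr_gt0 // invf_div.
    have : p%:R / (x j)%:R <= e / 4.
      rewrite ler_pdivrMr ?(lt_le_trans N0) // mulrAC ler_pdivlMr // mulrC -ler_pdivrMl // mulrC.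
      apply: (@le_trans _ _ (4 * Y%:R / e)); last by lra.
      by rewrite [leLHS]mulrC ler_pM2r ?invr_gt0 // mulrC ler_pM2l // ler_nat.
    lra.
  - by move=> p /inP[].
move=> p [q [[pp pq gp gq] [/andP[_ pY] /andP[_ qY] pq1 pq2]]].
have p0 := prime_gt0 pp; have q0 := prime_gt0 pq.
have p0' : 0 < p%:R :> R by rewrite ltr0n.
have q0' : 0 < q%:R :> R by rewrite ltr0n.
have pleq : (p <= q)%N by rewrite -(ler_nat R); apply: le_trans pq1; rewrite ler_peMl // lerDl ltW.
have good j : (j <= 2 * k)%N -> forall r, ~~ has (fun j => bad j r) (iota 0 (2 * k).+1) ->
    `|m (x j) + m (x j %/ r)| <= e.
  move=> jk r /hasPn/(_ j); rewrite mem_iota add0n ltnS jk => /(_ isT).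
  by rewrite -leNgt.
(* [x j] is the last term of the progression that does not exceed N q / p. *)
pose V := (N * q %/ p)%N; pose j := ((V - N) %/ D)%N.
have [V1 V2] := divn_bounds R (N * q) p0; rewrite -/V in V1 V2.
have NqE : (N * q)%:R / p%:R = N%:R * (q%:R / p%:R) :> R by rewrite natrM mulrA.
have qp1 : 1 + d2 <= q%:R / p%:R by rewrite ler_pdivlMr.
have qp2 : q%:R / p%:R <= 1 + d by rewrite ler_pdivrMr.
have Nqp1 : N%:R * (1 + d2) <= N%:R * (q%:R / p%:R) by rewrite ler_pM2l.
have Nqp2 : N%:R * (q%:R / p%:R) <= N%:R * (1 + d) by rewrite ler_pM2l.
have NV : (N <= V)%N by rewrite /V leq_divRL // leq_mul2l pleq orbT.
have D0 : (0 < D)%N.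
  by rewrite lt0n; apply: contraTneq N0 => D00; move: Dk; rewrite D00 mulr0 -leNgt.
have N'V : (x j <= V)%N.
  by rewrite /x -leq_subRL // /j; exact: leq_divM.
have VN' : (V <= x j + D)%N.
  by rewrite /x -addnA -leq_subLR addnC -mulSn; apply/ltnW/ltn_ceil.
have jk : (j <= 2 * k)%N.
  rewrite /j -ltnS ltn_divLR // -(ltr_nat R) natrM -natr1 natrB //.
  have D0' : 0 < D%:R :> R by rewrite ltr0n.
  have : N%:R * (1 + d) <= N%:R * 2 by rewrite ler_pM2l //; lra.
  rewrite NqE in V2; lra.
exists (x j).
have VN'r : V%:R <= (x j)%:R + D%:R :> R by rewrite -natrD ler_nat.
have N'Vr : (x j)%:R <= V%:R :> R by rewrite ler_nat.
have dk : N%:R / k%:R <= N%:R * (d2 / 4) :> R.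
  rewrite ler_pM2l // -[leRHS]invrK lef_pV2 ?posrE ?invr_gt0 ?divr_gt0 // invf_div; lra.
have dN : 1 <= N%:R * (d2 / 4).
  by rewrite mulrA ler_pdivlMr // mul1r -ler_pdivrMr //; lra.
rewrite NqE in V1 V2.
split.
- lra.
- lra.
have g1 := good 0%N (leq0n _) p gp; rewrite /x mul0n addn0 in g1.
have g2 := good j jk q gq.
have : `|m (N %/ p) - m (x j %/ q)| <= 4 / k%:R.
  apply: mertens_mean_ratio => //.
  - by rewrite p0.
  - have : 4 * k%:R * p%:R <= 4 * k%:R * Y%:R :> R by rewrite ler_pM2l ?mulr_gt0 // ler_nat ltnW.
    lra.
  - apply: (@leq_trans (V * p)); first by rewrite leq_mul2r N'V orbT.
    exact: leq_divM.
  - rewrite -ler_pdivrMr // NqE; lra.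
have : 4 / k%:R <= tau / 2.
  by rewrite ler_pdivrMr // mulrC -ler_pdivrMr ?divr_gt0 // invf_div mulrA; lra.
move=> h3 h4; move: g1 g2 (le_trans h4 h3); rewrite !ler_norml eE.
by move=> /andP[? ?] /andP[? ?] /andP[? ?]; apply/andP; split; lra.
Qed.

(** Each of the [K] steps adds [tau] to the deviation at its endpoints. Between two endpoints, whose
    ratio is at most 1 + d, [mertens_mean_lip] adds 2d, and only once. *)
Lemma mertens_mean_const (d d' tau : R) (N0 K : nat) :
  0 < d' -> 0 < tau -> (0 < N0)%N ->
  (forall N, (N0 <= N)%N -> exists N' : nat,
      [/\ (1 + d') * N%:R <= N'%:R, N'%:R <= (1 + d) * N%:R & `|m N' - m N| <= tau]) ->
  forall N, (N0 <= N)%N -> exists N' : nat,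
    [/\ (N <= N')%N, (1 + d') ^+ K * N%:R <= N'%:R, `|m N' - m N| <= K%:R * tau &
      forall n, (N <= n <= N')%N -> `|m n - m N| <= K%:R * tau + 2 * d].
Proof.
move=> d'0 tau0 N00 step N NN; have N0' : (0 < N)%N by exact: leq_trans NN.
elim: K => [|K [N1 [NN1 N1g N1m N1c]]].
  exists N; rewrite expr0 !mul1r subrr normr0 mul0r; split => // n; rewrite -eqn_leq => /eqP <-.
  rewrite subrr normr0 add0r.
  (* A single step forces d' <= d, so that 2d is nonnegative. *)
  have [N' [h1 h2 _]] := step N NN.
  have : (1 + d') * N%:R <= (1 + d) * N%:R by exact: le_trans h2.
  by rewrite ler_pM2r ?ltr0n //; lra.
have [N2 [h1 h2 h3]] := step N1 (leq_trans NN NN1).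
have N10 : 0 < N1%:R :> R by rewrite ltr0n (leq_trans N0').
have N12 : (N1 <= N2)%N by rewrite -(ler_nat R); apply: le_trans h1; rewrite ler_peMl // ; lra.
exists N2; split.
- exact: leq_trans N12.
- apply: le_trans h1; rewrite exprS -mulrA ler_pM2l //; lra.
- move: N1m h3; rewrite !ler_norml -natr1 => /andP[? ?] /andP[? ?]; apply/andP; split; lra.
move=> n /andP[n1 n2]; case: (leqP n N1) => nN1.
  apply: le_trans (N1c n _) _; first by rewrite n1.
  by rewrite -natr1; lra.
have n0 : (0 < n)%N by exact: leq_trans nN1.
have := mertens_mean_lip R (ltnW nN1) n0.
have n0' : 0 < n%:R :> R by rewrite ltr0n.
have n2' : n%:R <= N2%:R :> R by rewrite ler_nat.
have n1' : N1%:R <= n%:R :> R by rewrite ler_nat ltnW.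
have : 2 * (n%:R - N1%:R) / n%:R <= 2 * d.
  rewrite ler_pdivrMr // -mulrA ler_pM2l //.
  have d0 : 0 <= d.
    have : (1 + d') * N1%:R <= (1 + d) * N1%:R by exact: le_trans h2.
    by rewrite ler_pM2r //; lra.
  have : d * N1%:R <= d * n%:R by rewrite ler_wpM2l.
  lra.
move=> h4 h5; move: (le_trans h5 h4) N1m; rewrite !ler_norml -natr1.
by move=> /andP[? ?] /andP[? ?]; apply/andP; split; lra.
Qed.

Lemma sum_moebius_div_abel (N N' : nat) : (0 < N <= N')%N ->
  \sum_(N <= n < N') mu n.+1 / n.+1%:R =
  m N' - m N + \sum_(N <= n < N') m n / n.+1%:R.
Proof.
case/andP=> N0; elim: N' => [|N' IH]; first by rewrite leqNgt N0.
rewrite leq_eqVlt => /orP[/eqP <-|]; first by rewrite !big_geq // subrr addr0.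
rewrite ltnS => NN; rewrite big_nat_recr // [in RHS]big_nat_recr //= IH //.
have -> : mu N'.+1 = M N'.+1 - M N' by rewrite /mertens big_nat_recr //= addrAC subrr add0r.
have N'0 : N'%:R != 0 :> R by rewrite pnatr_eq0 -lt0n (leq_trans N0).
rewrite /mertens_mean -natr1; field.
by rewrite N'0 natr1 !pnatr_eq0 (gtn_eqF N0).
Qed.

(** By the Abel identity this is a difference of two partial sums of mu(k)/k minus a difference of
    two values of m: four quantities, each at most 1. *)
Lemma norm_sum_mertens_mean_le (N N' : nat) : (0 < N <= N')%N ->
  `|\sum_(N <= n < N') m n / n.+1%:R| <= 4.
Proof.
move=> /[dup] NN' /andP[N0 NN]; have := sum_moebius_div_abel NN'.
have -> : \sum_(N <= n < N') mu n.+1 / n.+1%:R =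
   \sum_(1 <= k < N'.+1) mu k / k%:R - \sum_(1 <= k < N.+1) mu k / k%:R.
  rewrite [X in X - _](big_cat_nat (n := N.+1)) //= addrAC subrr add0r.
  by rewrite big_add1.
have := norm_sum_moebius_div_le R N; have := norm_sum_moebius_div_le R N'.
have := norm_mertens_mean_le1 R N; have := norm_mertens_mean_le1 R N'.
rewrite !ler_norml => /andP[? ?] /andP[? ?] /andP[? ?] /andP[? ?] ?.
by apply/andP; split; lra.
Qed.

Theorem mertens_littleo (eps : R) : 0 < eps ->
  exists N0 : nat, forall N, (N0 <= N)%N -> `|M N| <= eps * N%:R.
Proof.
move=> eps0; wlog eps1 : eps eps0 / eps <= 1.
  move=> H; case: (leP eps 1) => e1; first exact: H.
  have [N0 HN] := H 1 ltr01 (lexx _); exists N0 => N NN.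
  by apply: le_trans (HN _ NN) _; rewrite ler_wpM2r // ltW.
(* With H the sum of 1/(n + 1) over [N, N'), the end result is |m N| H <= 4 + (K tau + 2d) H. Here K
   tau = eps/8 and 2d = eps/4, and H >= 8/eps turns 4 into at most (eps/2) H. *)
pose d := eps / 8; have d0 : 0 < d by rewrite divr_gt0.
have d1 : d <= 1 by rewrite /d; lra.
have [d' d'0 step] := mertens_mean_step d0 d1.
have d'1 : 0 < 1 + d' by exact: addr_gt0.
have ld : 0 < ln (1 + d') by rewrite ln_gt0 // ltrDl.
have ln2 : ln 2 <= 1 :> R by have := @le_ln1Dx R 1 ltac:(lra); rewrite -[1 + 1]/(2).
(* The extra 1 pays for ln 2 in ln(N + 1) <= ln 2 + ln N. *)
pose K := (Num.truncn ((8 / eps + 1) / ln (1 + d'))).+1.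
have KA : 8 / eps + 1 <= K%:R * ln (1 + d').
  by rewrite -ler_pdivrMr //; apply/ltW/truncnS_gt.
pose tau := eps / (8 * K%:R); have K0 : 0 < K%:R :> R by rewrite ltr0n.
have tau0 : 0 < tau by rewrite divr_gt0 // mulr_gt0.
have Kt : K%:R * tau = eps / 8 by rewrite /tau; field; rewrite gt_eqF.
have [N0 HN0] := step tau tau0.
exists N0.+1 => N NN; have N0' : (0 < N)%N by exact: leq_trans NN.
have [|N' [NN' ge _ near]] := @mertens_mean_const d d' tau N0.+1 K d'0 tau0 isT _ N NN.
  by move=> n /ltnW; exact: HN0.
have Np : 0 < N%:R :> R by rewrite ltr0n.
pose H := \sum_(N <= n < N') (n.+1%:R)^-1 : R.
have HA : 8 / eps <= H.
  have E : H = \sum_(N.+1 <= n < N'.+1) (n%:R)^-1 by rewrite /H [RHS]big_add1.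
  have NN1 : (0 < N.+1 <= N'.+1)%N by [].
  have := sum_inv_ge_ln R NN1; rewrite -E => H1.
  have l1 : ln N.+1%:R <= ln 2 + ln N%:R :> R.
    rewrite -lnM ?posrE // ler_ln ?posrE ?mulr_gt0 // -natrM ler_nat.
    by rewrite mul2n -addnn -add1n leq_add2r.
  have l2 : K%:R * ln (1 + d') + ln N%:R <= ln N'.+1%:R :> R.
    have -> : K%:R * ln (1 + d') = ln ((1 + d') ^+ K) by rewrite lnXn ?mulr_natl.
    have q0 : 0 < (1 + d') ^+ K by rewrite exprn_gt0.
    rewrite -lnM ?posrE // ler_ln ?posrE ?mulr_gt0 //.
    by apply: le_trans ge _; rewrite ler_nat.
  lra.
have eH : 8 <= H * eps by rewrite -ler_pdivrMr.
have H0 : 0 < H by apply: lt_le_trans HA; rewrite divr_gt0.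
have N0N' : (0 < N <= N')%N by rewrite N0'.
have := norm_sum_mertens_mean_le N0N'.
have dist : `|m N * H - \sum_(N <= n < N') m n / n.+1%:R| <= (K%:R * tau + 2 * d) * H.
  rewrite /H !mulr_sumr -sumrB; apply: le_trans (ler_norm_sum _ _ _) _.
  apply: ler_sum_nat => n /andP[n1 n2]; rewrite -mulrBl normrM normfV normr_nat.
  by rewrite ler_wpM2r ?invr_ge0 // distrC near // n1 ltnW.
move=> h4; have h5 : `|m N| * H <= eps * H.
  rewrite -{1}(gtr0_norm H0) -normrM.
  have := ler_normD (m N * H - \sum_(N <= n < N') m n / n.+1%:R) (\sum_(N <= n < N') m n / n.+1%:R).
  rewrite subrK => h6; apply: le_trans h6 _; rewrite Kt /d in dist; lra.
move: h5; rewrite ler_pM2r // /mertens_mean normrM normfV normr_nat.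
by rewrite ler_pdivrMr.
Qed.

End MertensLittleo.

(** * From M(N) = o(N) to the lower bound for the number of primes *)

Section PrimeCounting.
Variable R : realType.
Local Notation mu := (@moebius R).
Local Notation M := (@mertens R).

(** Both sides count the pairs (j, m) of positive integers with p^j m <= n. *)
Lemma logn_fact_trunc_log (p n : nat) : prime p ->
  logn p n`! = (\sum_(1 <= m < n.+1) trunc_log p (n %/ m))%N.
Proof.
move=> pp; have p1 := prime_gt1 pp; rewrite logn_fact //.
under [RHS]eq_big_nat => m /andP[m0 mn].
  rewrite (@trunc_log_sum p _ n) //; last by rewrite divn_gt0 // -ltnS mn leq_div.
  over.
rewrite exchange_big /=; apply: eq_big_nat => j /andP[j0 _].
have pj : (0 < p ^ j)%N by rewrite expn_gt0 prime_gt0.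
have le : (n %/ p ^ j <= n)%N by exact: leq_div.
rewrite (big_cat_nat (n := (n %/ p ^ j).+1)) //=.
rewrite [X in (_ + X)%N]big_nat [X in (_ + X)%N]big1 ?addn0; last first.
  move=> k /andP[k1 _]; have k0 : (0 < k)%N by exact: leq_trans k1.
  apply/eqP; rewrite eqb0 -ltnNge ltn_divLR // mulnC -ltn_divLR //.
rewrite (eq_big_nat _ _ (F2 := fun=> 1%N)).
  by rewrite sum_nat_const_nat muln1 subn1.
move=> k /andP[k0]; rewrite ltnS => kt.
by rewrite leq_divRL // mulnC -leq_divRL // kt.
Qed.

Lemma ln_logn (k N : nat) : (0 < k <= N)%N ->
  ln (k%:R : R) = \sum_(0 <= p < N.+1 | prime p) (logn p k)%:R * ln p%:R.
Proof.
case/andP=> k0 kN; rewrite -{1}(partnT k0) /partn.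
have -> : \sum_(0 <= p < N.+1 | prime p) (logn p k)%:R * ln p%:R =
   \sum_(0 <= p < k.+1) (logn p k)%:R * ln p%:R :> R.
  rewrite big_mkcond (big_cat_nat (n := k.+1)) //= [X in _ + X]big_nat [X in _ + X]big1.
    rewrite addr0; apply: eq_bigr => p _; case: ifP => // pp.
    by rewrite /logn pp mul0r.
  move=> p /andP[kp _]; case: ifP => // pp.
  by rewrite lognE pp k0 /= gtnNdvd // mul0r.
elim: (index_iota 0 k.+1) => [|p s IH]; first by rewrite !big_nil ln1.
rewrite !big_cons /= natrM natrX.
case: (boolP (prime p)) => pp; last first.
  by rewrite {1}/logn (negPf pp) expr0 mul1r IH [X in X%:R * _]/logn (negPf pp) mul0r add0r.
have p0 : 0 < p%:R :> R by rewrite ltr0n prime_gt0.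
rewrite lnM ?posrE ?exprn_gt0 // ?lnXn // ?IH ?mulr_natl //.
rewrite ltr0n prodn_gt0 // => q _; rewrite expn_gt0 lognE.
Qed.

Lemma ln_fact_logn (n N : nat) : (n <= N)%N ->
  ln (n`!%:R : R) = \sum_(0 <= p < N.+1 | prime p) (logn p n`!)%:R * ln p%:R.
Proof.
elim: n => [|n IH] nN; first by rewrite fact0 ln1 big1 // => p _; rewrite logn1 mul0r.
rewrite factS natrM lnM ?posrE ?ltr0n ?fact_gt0 // IH ?(ltnW nN) // (ln_logn (N := N)) //.
rewrite -big_split /=; apply: eq_bigr => p _.
by rewrite [in RHS]lognM ?fact_gt0 // natrD mulrDl.
Qed.

(** [trunc_log p N] counts the powers p^j <= N with j >= 1, so this is the summatory function of von
    Mangoldt's function. *)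
Definition chebyshev_psi (N : nat) : R :=
  \sum_(0 <= p < N.+1 | prime p) (trunc_log p N)%:R * ln p%:R.

(** Inversion of ln floor(N/a)! = sum over m of psi(N/(am)). In [F] all primes up to N may be kept,
    since those beyond N/k have [trunc_log] equal to 0. *)
Lemma sum_moebius_ln_fact (N : nat) : (0 < N)%N ->
  \sum_(1 <= a < N.+1) mu a * ln ((N %/ a)`!%:R) = chebyshev_psi N.
Proof.
move=> N0.
pose F k : R := \sum_(0 <= p < N.+1 | prime p) (trunc_log p (N %/ k))%:R * ln p%:R.
have -> : chebyshev_psi N = F 1%N by rewrite /F divn1.
rewrite -(@moebius_inversion_sum R F N N0).
apply: eq_big_nat => a /andP[a0 _]; congr (_ * _).
rewrite (ln_fact_logn (leq_div N a)) /F exchange_big /=; apply: eq_bigr => p pp.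
rewrite logn_fact_trunc_log // natr_sum mulr_suml; apply: eq_bigr => m _.
by rewrite divnMA.
Qed.

Lemma chebyshev_psi_le (N : nat) : (0 < N)%N ->
  chebyshev_psi N <= (\sum_(0 <= p < N.+1 | prime p) 1)%N%:R * ln N%:R.
Proof.
move=> N0; rewrite natr_sum mulr_suml; apply: ler_sum => p pp.
have p0 : 0 < p%:R :> R by rewrite ltr0n prime_gt0.
rewrite mul1r mulr_natl -lnXn // ler_ln ?posrE ?exprn_gt0 // ?ltr0n //.
by rewrite -natrX ler_nat trunc_logP // prime_gt1.
Qed.

Definition harmonic_sum (n : nat) : R := \sum_(1 <= k < n.+1) (k%:R)^-1.
Local Notation H := harmonic_sum.

Lemma sum_moebius_harmonic (N : nat) : (0 < N)%N ->
  \sum_(1 <= a < N.+1) mu a * (N%:R / a%:R * H (N %/ a)) = N%:R.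
Proof.
move=> N0.
apply: etrans (etrans (@moebius_inversion_sum R (fun k => N%:R / k%:R) N N0) (divr1 _)).
apply: eq_big_nat => a _; congr (_ * _).
by rewrite /H mulr_sumr; apply: eq_bigr => k _; rewrite natrM invfM mulrA.
Qed.

Lemma sum_moebius_divn (N : nat) : (0 < N)%N ->
  \sum_(1 <= a < N.+1) mu a * (N %/ a)%:R = 1.
Proof.
move=> N0; apply: etrans (@moebius_inversion_sum R (fun=> 1) N N0).
by apply: eq_big_nat => a _; rewrite sumr_const_nat subn1.
Qed.

Lemma harmonic_sum_diff (n n' : nat) : (0 < n <= n')%N ->
  ln n'.+1%:R - ln n.+1%:R <= H n' - H n :> R /\ H n' - H n <= ln n'%:R - ln n%:R :> R.
Proof.
move=> /[dup] nn /andP[n0 nn'].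
have -> : H n' - H n = \sum_(n <= l < n') (l.+1%:R)^-1.
  by rewrite /H (big_cat_nat (n := n.+1)) //= addrAC subrr add0r big_add1.
split; last exact: sum_inv_le_ln.
have nn1 : (0 < n.+1 <= n'.+1)%N by [].
by have := sum_inv_ge_ln R nn1; rewrite big_add1.
Qed.

(** Every [v k] is at most every [u n], and [u n] exceeds [v n] by at most 1/n; the supremum of the
    [v k] is therefore the constant. *)
Lemma euler_constant : exists g : R, forall n : nat, (0 < n)%N ->
  0 <= H n - ln n%:R - g <= n%:R^-1.
Proof.
pose u n : R := H n - ln n%:R; pose v n : R := H n - ln n.+1%:R.
have vu n : (0 < n)%N -> v n <= u n <= v n + n%:R^-1.
  move=> n0; have n0' : 0 < n%:R :> R by rewrite ltr0n.
  have : ln n%:R <= ln n.+1%:R :> R by rewrite ler_ln ?posrE // ler_nat.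
  have : ln n.+1%:R <= ln n%:R + n%:R^-1 :> R.
    rewrite -lerBlDl -ln_div ?posrE //.
    have -> : n.+1%:R / n%:R = 1 + n%:R^-1 :> R by rewrite -natr1; field; rewrite gt_eqF.
    by apply: le_ln1Dx; rewrite (@lt_trans _ _ 0) ?invr_gt0 //; lra.
  by rewrite /u /v; move: (ln n.+1%:R) => ?; lra.
have vub n k : (0 < n)%N -> (0 < k)%N -> v k <= u n.
  move=> n0 k0; have /andP[a1 _] := vu n n0; have /andP[b1 _] := vu k k0.
  case: (leqP n k) => nk.
    have nk' : (0 < n <= k)%N by rewrite n0.
    by have [_] := harmonic_sum_diff nk'; rewrite /u /v in a1 b1 *; lra.
  have nk' : (0 < k <= n)%N by rewrite k0 ltnW.
  by have [] := harmonic_sum_diff nk'; rewrite /u /v in a1 b1 *; move: (ln k.+1%:R) (ln n.+1%:R) a1 b1 => ??; lra.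
pose S := [set v k | k in [set k : nat | (0 < k)%N]].
have S1 : S (v 1%N) by exists 1%N.
have ubS n : (0 < n)%N -> ubound S (u n) by move=> n0 _ [k k0 <-]; exact: vub.
exists (sup S) => n n0; have /andP[a1 a2] := vu n n0.
have l1 : sup S <= u n by apply: ge_sup; [exists (v 1%N) | exact: ubS].
have l2 : v n <= sup S by apply: ub_le_sup; [exists (u n); exact: ubS | exists n].
by apply/andP; split; rewrite /u in a1 a2 l1; lra.
Qed.

Lemma ln_fact_bounds (n : nat) : (0 < n)%N ->
  n%:R * ln n%:R - n%:R <= ln n`!%:R :> R /\
  ln n`!%:R <= n%:R * ln n%:R - n%:R + 1 + ln n%:R :> R.
Proof.
elim: n => // n IH _; case: (posnP n) => [->|n0].
  by rewrite factS fact0 muln1 ln1; split; lra.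
have [] := IH n0; rewrite factS natrM lnM ?posrE ?ltr0n ?fact_gt0 //.
have n0' : 0 < n%:R :> R by rewrite ltr0n.
have n1' : 0 < n.+1%:R :> R by [].
have h1 : n%:R * (ln n.+1%:R - ln n%:R) <= 1 :> R.
  rewrite -ler_pdivlMl // mulr1 -ln_div ?posrE //.
  have -> : n.+1%:R / n%:R = 1 + n%:R^-1 :> R by rewrite -natr1; field; rewrite gt_eqF.
  by apply: le_ln1Dx; rewrite (@lt_trans _ _ 0) ?invr_gt0 //; lra.
have h2 : 1 <= n.+1%:R * (ln n.+1%:R - ln n%:R) :> R.
  rewrite -ler_pdivrMl // mulr1 -opprB lerNr -ln_div ?posrE //.
  have -> : n%:R / n.+1%:R = 1 + - n.+1%:R^-1 :> R.
    by rewrite -natr1; field; rewrite natr1 gt_eqF.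
  by apply: le_ln1Dx; rewrite ltrN2 invf_lt1 // ltr1n.
move: h1 h2; rewrite -!natr1; move: (ln (n%:R + 1)) (ln n%:R) (ln n`!%:R) => x y z.
by move=> *; split; lra.
Qed.

Lemma sum_moebius_antitone (f : nat -> R) (A N : nat) (E : R) :
  (A < N)%N -> (forall n, (A <= n <= N)%N -> `|M n| <= E) ->
  (forall n, (A < n <= N)%N -> 0 <= f n) -> (forall n, (A < n < N)%N -> f n.+1 <= f n) ->
  `|\sum_(A.+1 <= a < N.+1) mu a * f a| <= 2 * E * f A.+1.
Proof.
move=> AN ME f0 fd.
(* Abel summation as an invariant: [E * f A.+1] bounds the lower boundary term and
   [E * (f A.+1 - f n)] the variation of [f]. *)
have key n : (A < n <= N)%N -> `|\sum_(A.+1 <= a < n.+1) mu a * f a - M n * f n| <=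
    E * (2 * f A.+1 - f n).
  elim: n => // n IH /andP[An nN]; rewrite big_nat_recr //=.
  have MS : M n.+1 = M n + mu n.+1 by rewrite /mertens big_nat_recr.
  have E0 : 0 <= E by apply: le_trans (normr_ge0 _) (ME N _); rewrite leqnn ltnW.
  move: An; rewrite ltnS leq_eqVlt => /orP[/eqP An|An].
    rewrite -An big_geq // add0r An MS -mulrBl opprD addrCA subrr addr0 normrM normrN.
    have -> : 2 * f n.+1 - f n.+1 = f n.+1 by lra.
    have fn : 0 <= f n.+1 by apply: f0; rewrite An leqnn.
    by rewrite (ger0_norm fn) ler_wpM2r // ME // An leqnn ltnW.
  have An' : (A < n <= N)%N by rewrite An ltnW.
  have -> : \sum_(A.+1 <= i < n.+1) mu i * f i + mu n.+1 * f n.+1 - M n.+1 * f n.+1 =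
     (\sum_(A.+1 <= i < n.+1) mu i * f i - M n * f n) + M n * (f n - f n.+1).
    by rewrite MS; ring.
  apply: le_trans (ler_normD _ _) _; apply: le_trans (lerD (IH An') (lexx _)) _.
  have fdn : 0 <= f n - f n.+1 by rewrite subr_ge0 fd // An.
  rewrite normrM (ger0_norm fdn).
  have : `|M n| * (f n - f n.+1) <= E * (f n - f n.+1).
    by rewrite ler_wpM2r // ME // (ltnW An) ltnW.
  lra.
have AN' : (A < N <= N)%N by rewrite AN leqnn.
have := key N AN'; have : `|M N| * `|f N| <= E * f N.
  by rewrite (ger0_norm (f0 _ AN')) ler_wpM2r ?f0 // ME // leqnn ltnW.
rewrite -normrM => h1 h2.
have := ler_normD (\sum_(A.+1 <= a < N.+1) mu a * f a - M N * f N) (M N * f N).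
rewrite subrK => h3; apply: le_trans h3 _; lra.
Qed.

End PrimeCounting.

Section PNT.
Variable R : realType.
Local Notation mu := (@moebius R).
Local Notation M := (@mertens R).
Local Notation H := (@harmonic_sum R).

Lemma harmonic_sum_ge0 n : 0 <= H n.
Proof. by apply: sumr_ge0 => k _; rewrite invr_ge0. Qed.

Lemma harmonic_sum_mono n n' : (n <= n')%N -> H n <= H n'.
Proof.
move=> nn; rewrite /H [leRHS](big_cat_nat (n := n.+1)) //= lerDl.
by apply: sumr_ge0 => k _; rewrite invr_ge0.
Qed.

Lemma harmonic_sum_le n : (0 < n)%N -> H n <= 1 + ln n%:R.
Proof.
move=> n0; have n1 : (0 < 1 <= n)%N by [].
have [_] := harmonic_sum_diff R n1.
by rewrite {2}/H big_nat1 invr1 ln1; lra.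
Qed.

(* With [y = N / a], the combination [ln [y]! - y H([y]) + (1 + g) [y]] is only [O(1 + ln y)], and its Moebius transform is [psi N - N + (1 + g)]. *)
Lemma axer_kernel_bound (g : R) (N a : nat) :
  (forall n : nat, (0 < n)%N -> 0 <= H n - ln n%:R - g <= n%:R^-1) ->
  (0 < a <= N)%N ->
  `|ln (N %/ a)`!%:R - N%:R / a%:R * H (N %/ a) + (1 + g) * (N %/ a)%:R|
  <= 2 + ln N%:R - ln a%:R.
Proof.
move=> Hg /andP[a0 aN]; have n0 : (0 < N %/ a)%N by rewrite divn_gt0.
have N0 : (0 < N)%N by exact: leq_trans aN.
have [y1 y2] := divn_bounds R N a0.
have /andP[u1 u2] := Hg _ n0; have h1 := harmonic_sum_le n0.
have [t1 t2] := ln_fact_bounds R n0.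
have h0 := harmonic_sum_ge0 (N %/ a).
have n0' : 0 < (N %/ a)%:R :> R by rewrite ltr0n.
have lnn : ln (N %/ a)%:R <= ln N%:R - ln a%:R :> R.
  by rewrite -ln_div ?posrE ?ltr0n // ler_ln ?posrE // divr_gt0 ?ltr0n.
move: (N%:R / a%:R) y1 y2 => y y1 y2.
have u3 : (N %/ a)%:R * (H (N %/ a) - ln (N %/ a)%:R - g) <= 1.
  by rewrite -ler_pdivlMl // mulr1.
have u4 : 0 <= (N %/ a)%:R * (H (N %/ a) - ln (N %/ a)%:R - g).
  by rewrite mulr_ge0 // ltW.
move: ((N %/ a)%:R : R) (H (N %/ a)) (ln (N %/ a)`!%:R : R) (ln (N %/ a)%:R : R) y1 y2 u1 u2 h1 t1 t2 h0 n0' lnn u3 u4.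
move=> n h T l y1 y2 u1 u2 h1 t1 t2 h0 n0' lnn u3 u4.
have w1 : (y - n) * h <= 1 * h by rewrite ler_wpM2r //; lra.
have w2 : 0 <= (y - n) * h by rewrite mulr_ge0 // subr_ge0.
by rewrite ler_norml; apply/andP; split; lra.
Qed.

Lemma chebyshev_psi_ge (eps : R) : 0 < eps ->
  exists N0 : nat, forall N, (N0 <= N)%N -> (1 - eps) * N%:R <= chebyshev_psi R N.
Proof.
move=> eps0; have [g Hg] := euler_constant R.
(* As B = K^2, ln(N/A) is at most 1 + 2K while A <= N/K^2. The terms a <= A then contribute at most
   A (4 + 2K) <= 6N/K <= (eps/4) N. *)
pose K := (Num.truncn (24 / eps)).+1; pose B := (K * K)%N.
have K1 : 1 <= K%:R :> R by rewrite ler1n.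
have K0 : 0 < K%:R :> R by lra.
have KE : 24 <= eps * K%:R by rewrite mulrC -ler_pdivrMr //; apply/ltW/truncnS_gt.
have B0 : (0 < B)%N by [].
have BE : B%:R = K%:R * K%:R :> R by rewrite natrM.
have lnK : ln K%:R <= K%:R :> R by apply/ltW/ln_sublinear.
clearbody K.
(* Abel summation is applied to the three antitone pieces of [F] separately; [G] bounds their total
   weight at a = A + 1, where N/a <= B. *)
pose G := ln B`!%:R + B%:R * H B + `|1 + g| * B%:R.
have lB0 : 0 <= ln (B`!%:R : R) by rewrite ln_ge0 // ler1n fact_gt0.
have HB0 := harmonic_sum_ge0 B.
have G0 : 0 <= G by rewrite /G !addr_ge0 ?mulr_ge0.
pose e := eps / (8 * (G + 1)); have e0 : 0 < e by rewrite divr_gt0 //; lra.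
have eG : e * G <= eps / 8.
  rewrite /e mulrAC ler_pdivrMr; last by lra.
  by have := mulr_ge0 (ltW eps0) G0; lra.
have [N1 HN1] := mertens_littleo e0.
pose N2 := (Num.truncn (4 * `|1 + g| / eps)).+1.
exists (N1.+1 * B + N2)%N => N NN.
have gN : `|1 + g| <= eps / 4 * N%:R.
  have : 4 * `|1 + g| / eps <= N%:R.
    apply: le_trans (ltW (truncnS_gt _)) _; rewrite ler_nat; apply: leq_trans NN.
    exact: leq_addl.
  by rewrite ler_pdivrMr //; lra.
have {}NN : (N1.+1 * B <= N)%N by apply: leq_trans NN; exact: leq_addr.
(* Below [A] the kernel bound suffices; above [A] the arguments [N %/ a] are bounded and Abel summation exploits M(N) = o(N). *)
pose A := (N %/ B)%N; have N1A : (N1 < A)%N by rewrite /A leq_divRL.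
have A0 : (0 < A)%N by exact: leq_trans N1A.
have AN' : (A <= N)%N by exact: leq_div.
have N0 : (0 < N)%N by exact: leq_trans AN'.
have N0' : 0 < N%:R :> R by rewrite ltr0n.
have A0' : 0 < A%:R :> R by rewrite ltr0n.
pose F a := ln (N %/ a)`!%:R - N%:R / a%:R * H (N %/ a) + (1 + g) * (N %/ a)%:R.
have psiE : chebyshev_psi R N = N%:R - (1 + g) + \sum_(1 <= a < N.+1) mu a * F a.
  have -> : \sum_(1 <= a < N.+1) mu a * F a =
     \sum_(1 <= a < N.+1) mu a * ln (N %/ a)`!%:R
     - \sum_(1 <= a < N.+1) mu a * (N%:R / a%:R * H (N %/ a))
     + (1 + g) * \sum_(1 <= a < N.+1) mu a * (N %/ a)%:R.
    rewrite mulr_sumr -sumrB -big_split /=; apply: eq_bigr => a _; rewrite /F.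
    by rewrite mulrDr mulrBr; congr (_ + _); rewrite mulrCA.
  by rewrite sum_moebius_ln_fact // sum_moebius_harmonic // sum_moebius_divn //; ring.
have S1 : `|\sum_(1 <= a < A.+1) mu a * F a| <= eps / 4 * N%:R.
  apply: le_trans (ler_norm_sum _ _ _) _.
  apply: (@le_trans _ _ (\sum_(1 <= a < A.+1) (2 + ln N%:R - ln a%:R))).
    apply: ler_sum_nat => a /andP[a0 aA]; rewrite normrM.
    apply: (@le_trans _ _ (1 * `|F a|)); first by rewrite ler_wpM2r ?norm_moebius_le1.
    rewrite mul1r; apply: axer_kernel_bound => //.
    by rewrite a0 (leq_trans _ AN').
  have -> : \sum_(1 <= a < A.+1) (2 + ln N%:R - ln a%:R) = A%:R * (2 + ln N%:R) - ln A`!%:R :> R.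
    rewrite sumrB sumr_const_nat subn1 /= mulr_natl; congr (_ - _).
    elim: (A) => [|k IH]; first by rewrite big_geq // fact0 ln1.
    by rewrite big_nat_recr //= IH factS natrM lnM ?posrE ?ltr0n ?fact_gt0 // addrC.
  have [h1 _] := ln_fact_bounds R A0.
  have lnNA : ln N%:R <= 1 + 2 * K%:R + ln A%:R :> R.
    have : ln N%:R <= ln ((2 * K%:R * K%:R) * A%:R) :> R.
      rewrite ler_ln ?posrE ?mulr_gt0 // -!natrM ler_nat.
      apply: ltnW; apply: leq_trans (ltn_ceil N B0) _; rewrite -/A /B.
      have -> : (2 * K * K * A = 2 * A * (K * K))%N by ring.
      by rewrite leq_mul2r mul2n -addnn -add1n leq_add2r A0 orbT.
    rewrite !lnM ?posrE ?mulr_gt0 //.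
    have := @le_ln1Dx R 1 ltac:(lra); rewrite -[1 + 1]/(2); lra.
  have h2 : A%:R * ln N%:R <= A%:R * (1 + 2 * K%:R + ln A%:R) :> R by rewrite ler_pM2l.
  have h3 : A%:R * (K%:R * K%:R) <= N%:R :> R by rewrite -BE -natrM ler_nat leq_divM.
  have h4 : A%:R * (4 + 2 * K%:R) * K%:R <= 6 * N%:R :> R.
    have : A%:R * K%:R <= A%:R * (K%:R * K%:R) :> R by rewrite ler_pM2l // ler_peMl.
    lra.
  have h5 : 24 * (A%:R * (4 + 2 * K%:R)) <= eps * (6 * N%:R).
    apply: (@le_trans _ _ (eps * (A%:R * (4 + 2 * K%:R) * K%:R))); last by rewrite ler_pM2l.
    have -> : eps * (A%:R * (4 + 2 * K%:R) * K%:R) = (eps * K%:R) * (A%:R * (4 + 2 * K%:R)) by ring.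
    rewrite ler_wpM2r // mulr_ge0 //; lra.
  lra.
have S2 : `|\sum_(A.+1 <= a < N.+1) mu a * F a| <= eps / 4 * N%:R.
  case: (ltnP A N) => AN; last by rewrite big_geq // normr0 mulr_ge0 // divr_ge0 // ltW.
  pose E := e * N%:R.
  have ME n : (A <= n <= N)%N -> `|M n| <= E.
    move=> /andP[An nN]; apply: le_trans (HN1 n _) _; first by rewrite (leq_trans _ An) // ltnW.
    by rewrite /E ler_pM2l // ler_nat.
  have E0 : 0 <= E by rewrite mulr_ge0 // ltW.
  have E2 : 0 <= 2 * E by apply: mulr_ge0.
  have dS n : (0 < n)%N -> (N %/ n.+1 <= N %/ n)%N by move=> n0; exact: leq_div2l.
  have gt0 n : (A < n)%N -> (0 < n)%N by exact: leq_trans.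
  have AB : (N %/ A.+1 <= B)%N by apply/ltnW; rewrite ltn_divLR // mulnC ltn_ceil.
  have NB : N%:R / A.+1%:R <= B%:R :> R.
    by rewrite ler_pdivrMr // -natrM ler_nat ltnW // mulnC ltn_ceil.
  have f1 := @sum_moebius_antitone R (fun a => ln (N %/ a)`!%:R) A N E AN ME.
  have {}f1 : `|\sum_(A.+1 <= a < N.+1) mu a * ln (N %/ a)`!%:R| <= 2 * E * ln B`!%:R.
    apply: le_trans (f1 _ _) _.
    - by move=> n _; rewrite ln_ge0 // ler1n fact_gt0.
    - move=> n /andP[An _]; rewrite ler_ln ?posrE ?ltr0n ?fact_gt0 // ler_nat.
      exact/leq_fact/dS/gt0.
    apply: (ler_wpM2l E2); rewrite ler_ln ?posrE ?ltr0n ?fact_gt0 // ler_nat.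
    exact: leq_fact.
  have f2 := @sum_moebius_antitone R (fun a => N%:R / a%:R * H (N %/ a)) A N E AN ME.
  have {}f2 : `|\sum_(A.+1 <= a < N.+1) mu a * (N%:R / a%:R * H (N %/ a))| <= 2 * E * (B%:R * H B).
    apply: le_trans (f2 _ _) _.
    - by move=> n _; rewrite mulr_ge0 ?divr_ge0 ?harmonic_sum_ge0.
    - move=> n /andP[An _]; have n0 := gt0 _ An.
      rewrite ler_pM ?divr_ge0 ?harmonic_sum_ge0 ?harmonic_sum_mono ?dS //.
      by rewrite ler_pM2l // lef_pV2 ?posrE ?ltr0n // ler_nat.
    apply: (ler_wpM2l E2); rewrite ler_pM ?divr_ge0 ?harmonic_sum_ge0 //.
    exact: harmonic_sum_mono.
  have f3 := @sum_moebius_antitone R (fun a => (N %/ a)%:R) A N E AN ME.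
  have {}f3 : `|\sum_(A.+1 <= a < N.+1) mu a * (N %/ a)%:R| <= 2 * E * B%:R.
    apply: le_trans (f3 _ _) _.
    - by move=> n _.
    - by move=> n /andP[An _]; rewrite ler_nat dS // gt0.
    by apply: (ler_wpM2l E2); rewrite ler_nat.
  have -> : \sum_(A.+1 <= a < N.+1) mu a * F a =
     \sum_(A.+1 <= a < N.+1) mu a * ln (N %/ a)`!%:R
     - \sum_(A.+1 <= a < N.+1) mu a * (N%:R / a%:R * H (N %/ a))
     + (1 + g) * \sum_(A.+1 <= a < N.+1) mu a * (N %/ a)%:R.
    rewrite mulr_sumr -sumrB -big_split /=; apply: eq_bigr => a _; rewrite /F.
    by rewrite mulrDr mulrBr; congr (_ + _); rewrite mulrCA.
  apply: le_trans (ler_normD _ _) _; apply: le_trans (lerD (ler_normB _ _) (lexx _)) _.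
  rewrite normrM; have f4 := ler_wpM2l (normr_ge0 (1 + g)) f3.
  have : e * G * N%:R <= eps / 8 * N%:R by rewrite ler_pM2r.
  rewrite /G /E in f1 f2 f4 *; lra.
rewrite psiE (big_cat_nat (n := A.+1)) //=.
have := ler_norm (1 + g); move: S1 S2; rewrite !ler_norml => /andP[? ?] /andP[? ?] ?.
lra.
Qed.

Lemma primes_below_ge (eps : R) : 0 < eps ->
  exists N0 : nat, forall N, (N0 <= N)%N ->
    (1 - eps) * N%:R <= (primes_below N.+1)%:R * ln N%:R.
Proof.
move=> eps0; have [N0 HN] := chebyshev_psi_ge eps0.
exists N0.+1 => N NN; apply: le_trans (HN N (ltnW NN)) _.
by apply: chebyshev_psi_le; exact: leq_trans NN.
Qed.

End PNT.

(** * Counting pairs of primes in windows of odd numbers *)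

Section Windows.
Variable R : realType.
Implicit Types (f a b : nat -> R) (L M N : nat).

Lemma sqr_sum_nat a L : (\sum_(0 <= i < L) a i) ^+ 2 =
  \sum_(0 <= i < L) a i ^+ 2 + 2 * \sum_(0 <= j < L) \sum_(0 <= i < j) a i * a j.
Proof.
elim: L => [|L IH]; first by rewrite !big_geq // expr0n mulr0 addr0.
rewrite !(big_nat_recr L) //= -mulr_suml sqrrD IH; ring.
Qed.

Lemma sum_distances f L : \sum_(0 <= j < L) \sum_(0 <= i < j) f (j - i)%N =
  \sum_(1 <= k < L.+1) (L%:R - k%:R) * f k.
Proof.
elim: L => [|L IH]; first by rewrite !big_geq.
rewrite big_nat_recr //= IH [RHS]big_nat_recr //= subrr mul0r addr0.
have -> : \sum_(0 <= i < L) f (L - i)%N = \sum_(1 <= k < L.+1) f k.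
  rewrite big_nat_rev /= [RHS]big_add1 /=; apply: eq_big_nat => i /andP[_ iL].
  by congr f; lia.
by rewrite -big_split /=; apply: eq_bigr => k _; rewrite -natr1; ring.
Qed.

Lemma sum_odd_le (G : nat -> R) M i : (forall n, 0 <= G n) ->
  \sum_(0 <= n < M) G (2 * (n + i)).+1 <= \sum_(0 <= p < 2 * (M + i)) G p.
Proof.
move=> G0; elim: M => [|M IH]; first by rewrite big_geq // sumr_ge0.
rewrite big_nat_recr //=.
have -> : (2 * (M.+1 + i) = (2 * (M + i)).+2)%N by lia.
rewrite !(big_nat_recr _.+1) //= (big_nat_recr (2 * (M + i))) //=.
by have := G0 (2 * (M + i))%N; move: IH; set u := G _.+1; lra.
Qed.

(** The term [2 * i] pays for the numbers below 2i, and [1 < M + i] for 2, the only even prime. *)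
Lemma primes_below_le_odd M i :
  (primes_below (2 * (M + i)) <=
   2 * i + \sum_(0 <= n < M) prime (2 * (n + i)).+1 + (1 < M + i))%N.
Proof.
have pb n : primes_below n.+1 = (primes_below n + prime n)%N.
  by rewrite /primes_below big_mkcond big_nat_recr //= -big_mkcond; case: prime.
elim: M => [|M IH].
  rewrite big_geq // addn0 add0n; apply: leq_trans (leq_addr _ _).
  rewrite /primes_below sum1_count; apply: leq_trans (count_size _ _) _.
  by rewrite size_iota subn0.
have -> : (2 * (M.+1 + i) = (2 * (M + i)).+2)%N by lia.
rewrite !pb big_nat_recr //=.
have : (prime (2 * (M + i)) + (1 < M + i) <= (1 < M.+1 + i))%N.
  rewrite addSn; move: (M + i)%N => [|[|n]] //.
  case: (boolP (prime _)) => // pr; have := dvdn_prime2 (isT : prime 2) pr.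
  by rewrite dvdn_mulr // mulnS.
move: IH; lia.
Qed.

(* If the window at [n] contains [w] primes, it contains [(w ^+ 2 - w) / 2] pairs; use [(w - m) ^+ 2 >= 0]. *)
Lemma sum_pairs_ge a M L (m : R) : (forall n, a n ^+ 2 = a n) -> 1 <= 2 * m ->
  \sum_(0 <= n < M) \sum_(0 <= j < L) \sum_(0 <= i < j) a (n + i)%N * a (n + j)%N
  >= ((2 * m - 1) * \sum_(0 <= n < M) \sum_(0 <= i < L) a (n + i)%N - m ^+ 2 * M%:R) / 2.
Proof.
move=> aa m1; rewrite ler_pdivrMr // mulr_sumr mulr_suml.
have -> : m ^+ 2 * M%:R = \sum_(0 <= n < M) m ^+ 2 by rewrite sumr_const_nat subn0 mulr_natr.
rewrite -sumrB; apply: ler_sum => n _.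
have := sqr_sum_nat (fun i => a (n + i)%N) L.
under [in X in _ = X + _ -> _]eq_bigr do rewrite aa.
set w := \sum_(0 <= i < L) a (n + i)%N => E.
have := sqr_ge0 (w - m); rewrite sqrrB E; lra.
Qed.

(** For a fixed offset i < L, the numbers 2(n + i) + 1 with n < M miss only O(L) odd numbers up to
    N; summation over i bounds the number of primes in all windows. For fixed i < j, distinct n give
    distinct pairs at distance 2(j - i), so each pair is counted at most once. *)
Lemma prime_pairs_windows N L (m : R) : (L <= N./2)%N -> 1 <= 2 * m ->
  ((2 * m - 1) * (L%:R * ((primes_below N.+1)%:R - 4 * L%:R - 4)) - m ^+ 2 * (N%:R / 2)) / 2 <=
  \sum_(1 <= k < L.+1) (L%:R - k%:R) *
     (\sum_(0 <= p < N.+1) (prime p && prime (p + 2 * k)%N)%:R) :> R.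
Proof.
move=> LN m1; pose M := (N./2 - L)%N.
pose b n : R := (prime (2 * n).+1)%:R.
have bb n : b n ^+ 2 = b n by rewrite /b; case: prime; rewrite ?expr1n ?expr0n.
have := sum_pairs_ge M L bb m1.
have N2 : (2 * N./2 <= N)%N by rewrite -[leqRHS]odd_double_half mul2n leq_addl.
have N2' : (N <= 2 * N./2 + 1)%N by rewrite -[leqLHS]odd_double_half mul2n addnC leq_add2l leq_b1.
have M2 : M%:R <= N%:R / 2 :> R.
  rewrite ler_pdivlMr // -natrM ler_nat mulnC; apply: leq_trans N2.
  by rewrite leq_mul2l leq_subr.
have first : L%:R * ((primes_below N.+1)%:R - 4 * L%:R - 4) <=
    \sum_(0 <= n < M) \sum_(0 <= i < L) b (n + i)%N.
  rewrite exchange_big /= -[X in X%:R * _]subn0 mulr_natl -sumr_const_nat.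
  apply: ler_sum_nat => i /andP[_ iL].
  have := primes_below_le_odd M i.
  have : (primes_below N.+1 <= primes_below (2 * (M + i)) + (N.+1 - 2 * (M + i)))%N.
    have MN : (2 * (M + i) <= N.+1)%N by rewrite /M; lia.
    rewrite /primes_below (big_cat_nat (n := 2 * (M + i))) //= leq_add2l sum1_count.
    by apply: leq_trans (count_size _ _) _; rewrite size_iota.
  have -> : \sum_(0 <= n < M) b (n + i)%N = (\sum_(0 <= n < M) prime (2 * (n + i)).+1)%N%:R.
    by rewrite natr_sum.
  set P := primes_below N.+1; set Q := primes_below _; set S := (\sum_(_ <= _ < _) _)%N.
  move=> h1 h2; have : (P <= S + 4 * L + 4)%N by move: h1 h2; rewrite /M; case: (1 < _)%N; lia.
  by rewrite -(ler_nat R) 2!natrD natrM; lra.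
have second : \sum_(0 <= n < M) \sum_(0 <= j < L) \sum_(0 <= i < j) b (n + i)%N * b (n + j)%N <=
  \sum_(1 <= k < L.+1) (L%:R - k%:R) *
     (\sum_(0 <= p < N.+1) (prime p && prime (p + 2 * k)%N)%:R).
  rewrite -sum_distances exchange_big /=; apply: ler_sum_nat => j /andP[_ jL].
  rewrite exchange_big /=; apply: ler_sum_nat => i /andP[_ ij].
  pose G p : R := (prime p && prime (p + 2 * (j - i))%N)%:R.
  have -> : \sum_(0 <= n < M) b (n + i)%N * b (n + j)%N = \sum_(0 <= n < M) G (2 * (n + i)).+1.
    apply: eq_bigr => n _; rewrite /b /G -natrM mulnb; congr (_ && prime _)%:R.
    by rewrite mulnBr; lia.
  apply: le_trans (@sum_odd_le G M i _) _; first by move=> n; exact: ler0n.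
  have MN : (2 * (M + i) <= N.+1)%N by rewrite /M; lia.
  rewrite [leRHS](big_cat_nat (n := 2 * (M + i))) //= lerDl.
  by apply: sumr_ge0 => p _; exact: ler0n.
move=> main; apply: le_trans (le_trans main second).
rewrite ler_pM2r ?invr_gt0 //; apply: lerB.
  by apply: ler_wpM2l => //; lra.
by apply: ler_wpM2l => //; exact: sqr_ge0.
Qed.

End Windows.

(** * Asymptotics and choice of parameters *)

Lemma prime_pair_countE (R : realType) (h : nat) (x : R) :
  (prime_pair_count h x)%:R =
  \sum_(0 <= p < (Num.truncn x).+1) (prime p && prime (p + h)%N)%:R :> R.
Proof.
rewrite /prime_pair_count -sum1_card -natr_sum; congr (_%:R).
rewrite big_mkord big_mkcond /=; apply: eq_bigr => p _.
by rewrite inE; case: (_ && _).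
Qed.

Lemma div_ln_ge (R : realType) (x : R) : 0 < ln x -> ln x / 2 <= x / ln x.
Proof.
move=> l0; have x0 : 0 < x.
  by rewrite ltNge; apply/negP => /ln0 l; rewrite l ltxx in l0.
have := @expR_ge1Dxn R (ln x) 1 (ltW l0); rewrite lnK ?posrE // -[2`!]/2%N => h.
rewrite ler_pdivlMr // mulrAC -expr2; lra.
Qed.

(* The optimal choice is [m = 2 * L / l], the expected number of primes in a window. *)
Lemma window_optimum (R : realFieldType) (Ci e l w L P N S : R) :
  0 < e -> 2 * e <= 1 -> 0 < l -> 0 < w -> 0 < L ->
  l <= 4 * L -> l <= (Ci + e) * L -> N <= w * l ^+ 2 ->
  (1 - 2 * e) * (w * l) <= P - 4 * L - 4 ->
  (forall m, 1 <= 2 * m ->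
    ((2 * m - 1) * (L * (P - 4 * L - 4)) - m ^+ 2 * (N / 2)) / 2 <= S) ->
  (1 - Ci / 2 - 9 / 2 * e) * w * L ^+ 2 <= S.
Proof.
move=> e0 e1 l0 w0 L0 lL lC Nw PD HS; set D := P - 4 * L - 4 in PD HS.
pose u := L / l; have u0 : 0 < u by rewrite divr_gt0.
have LE : L = u * l by rewrite /u divfK // gt_eqF.
have u1 : 1 <= 4 * u by rewrite /u mulrA ler_pdivlMr // mul1r.
have u2 : 1 <= (Ci + e) * u by rewrite /u mulrA ler_pdivlMr // mul1r.
have m1 : 1 <= 2 * (2 * u) by lra.
(* Divided by w l^2, the main term is u^2 - u/2, where u <= (Ci + e) u^2. The losses are 4 e u^2
   from [PD] and e u^2 / 2 from [u2], hence 9/2. *)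
apply: le_trans (HS _ m1); rewrite ler_pdivlMr //.
have wl0 : 0 < w * l ^+ 2 by rewrite mulr_gt0 ?exprn_gt0.
have h1 : (2 * (2 * u) - 1) * (L * ((1 - 2 * e) * (w * l))) <= (2 * (2 * u) - 1) * (L * D).
  apply: ler_wpM2l; first by lra.
  by rewrite ler_pM2l.
have h2 : (2 * u) ^+ 2 * (N / 2) <= (2 * u) ^+ 2 * (w * l ^+ 2 / 2).
  by apply: ler_wpM2l; [exact: sqr_ge0 | lra].
have h3 : u * (w * l ^+ 2) <= u * ((Ci + e) * u) * (w * l ^+ 2).
  by rewrite ler_pM2r // ler_peMr // ltW.
have h4 : 0 <= e * u * (w * l ^+ 2) by apply: mulr_ge0; [apply: mulr_ge0|]; exact: ltW.
move: h1; rewrite LE; move: h2 h3 h4; lra.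
Qed.

Lemma floor_truncn_ge0 (R : realType) (y : R) : 0 <= y ->
  (Num.floor y)%:~R = (Num.truncn y)%:R :> R.
Proof.
by move=> y0; rewrite truncn_floor y0 natr_absz ger0_norm ?floor_ge0.
Qed.

Theorem theorem2 (R : realType) (C : R) (E : R -> R)
  (hC : 1 / 2 < C)
  (hE_lower : \forall x \near +oo, C * ln x <= E x)
  (hE_upper : E =o_+oo (fun x => x / ln x ^+ 2)) :
  asymp_ge
    (fun x : R => 1 / (Num.floor (E x))%:~R ^+ 2 *
       \sum_(1 <= k < (Num.truncn (E x)).+1)
          ((Num.floor (E x))%:~R - k%:R) * (prime_pair_count (2 * k)%N x)%:R)
    (fun x : R => (1 - 1 / (2 * C)) * (x / ln x ^+ 2)).
Proof.
move=> eps eps0.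
have C0 : 0 < C by lra.
have Ci2 : C^-1 < 2 by rewrite invf_plt ?posrE //; lra.
have Ci0 : 0 < C^-1 by rewrite invr_gt0.
have cE : 1 / (2 * C) = C^-1 / 2 by field; rewrite gt_eqF.
rewrite cE; pose c := 1 - C^-1 / 2; have c0 : 0 < c by rewrite /c; lra.
have c1 : c <= 1 by rewrite /c; lra.
pose e1 := Num.min eps 1; have e10 : 0 < e1 by rewrite lt_min eps0 ltr01.
have e1eps : e1 <= eps by rewrite ge_min lexx.
have e11 : e1 <= 1 by rewrite ge_min lexx orbT.
(* The final comparison asks for 9/2 * e <= eps * c; 13 is a roomier constant, and the minimum in
   [e1] keeps e <= 1/13 also for large eps. *)
pose e := e1 * c / 13; have e0 : 0 < e by rewrite divr_gt0 // mulr_gt0.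
have ec : 13 * e <= eps * c.
  have : e1 * c <= eps * c by rewrite ler_pM2r.
  by rewrite /e; lra.
have e13 : 13 * e <= 1.
  have : e1 * c <= 1 * 1 by apply: ler_pM => //; exact: ltW.
  by rewrite /e; lra.
clearbody e; clear e1 e10 e1eps e11.
have e2 : 2 * e <= 1 by lra.
have [N0 HN0] := primes_below_ge e0.
(* [k1] lets e w l absorb the additive constants in [PD], [k2] ensures L >= 1, and [k3] absorbs the
   loss of 1 in passing from E(x) to its floor. *)
pose k1 := 20 / e; pose k2 := 2 / C; pose k3 := (C^-1 + e) / (e * C).
have k10 : 0 < k1 by rewrite divr_gt0.
have k20 : 0 < k2 by rewrite divr_gt0.
have k30 : 0 < k3 by rewrite divr_gt0 ?mulr_gt0 ?addr_gt0.
pose K : R := 16 + k1 + k2 + k3 + N0%:R.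
near=> x.
have El : C * ln x <= E x by near: x.
have Eu : `|E x| <= e * `|x / ln x ^+ 2|.
  by near: x; move/eqoP: hE_upper; apply.
have xK : expR K <= x by near: x; exact: nbhs_pinfty_ge.
have x0 : 0 < x by apply: lt_le_trans xK; exact: expR_gt0.
have lK : K <= ln x by rewrite -ler_expR lnK ?posrE.
have z1 : ln x / 2 <= x / ln x.
  apply: div_ln_ge; apply: lt_le_trans lK; rewrite /K.
  by have := ler0n R N0; lra.
have lx : ln x < x := ln_sublinear x0.
have l16 : 16 + k1 + k2 + k3 + N0%:R <= ln x by exact: lK.
have N00 := ler0n R N0.
have l0 : 0 < ln x by lra.
pose l := ln x; rewrite -/l in El Eu l0 l16 lx z1 *.
pose w := x / l ^+ 2; rewrite -/w in Eu *.
have w0 : 0 < w by rewrite divr_gt0 // exprn_gt0.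
have wl : w * l ^+ 2 = x by rewrite /w divfK // gt_eqF // exprn_gt0.
have wz : x / l = w * l by rewrite -wl expr2 mulrA mulfK // gt_eqF.
rewrite wz in z1.
have l1 : 20 <= e * l by rewrite mulrC -ler_pdivrMr // -/k1; lra.
have l2 : 2 <= C * l by rewrite mulrC -ler_pdivrMr // -/k2; lra.
have l3 : C^-1 + e <= e * C * l by rewrite mulrC -ler_pdivrMr ?mulr_gt0 // -/k3; lra.
have lE : l = ln x by [].
clearbody l.
have E0 : 0 <= E x by lra.
rewrite (gtr0_norm w0) (ger0_norm E0) in Eu.
rewrite floor_truncn_ge0 //.
have /andP[L1 L2] := truncn_itv E0; move: L1 L2; set L := Num.truncn (E x) => L1 L2.
rewrite -natr1 in L2.
have x00 : 0 <= x by exact: ltW.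
have /andP[n1 n2] := truncn_itv x00.
under eq_bigr do rewrite prime_pair_countE.
move: n1 n2; set N := Num.truncn x => n1 n2; rewrite -natr1 in n2.
have NN0 : (N0 <= N)%N by rewrite -ltnS -(ltr_nat R) -natr1; lra.
have l2l : l ^+ 2 = l * l by rewrite expr2.
have l256 : 16 * 16 <= l ^+ 2 by rewrite l2l; apply: ler_pM; lra.
have wx : w * (16 * 16) <= x by rewrite -[leRHS]wl ler_pM2l.
have w_wl : 16 * w <= w * l by rewrite mulrC ler_pM2l //; lra.
have wl0 : 0 < w * l by rewrite mulr_gt0.
have ew : e * (16 * w) <= e * (w * l) by rewrite ler_pM2l.
have ew1 : 13 * e * w <= 1 * w by rewrite ler_pM2r.
have ewl : e * (l / 2) <= e * (w * l) by rewrite ler_pM2l.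
have LN : (L <= N./2)%N.
  rewrite -leq_double -(leq_add2l (odd N)) odd_double_half.
  by rewrite -mul2n -(ler_nat R) natrD natrM; case: (odd N) => /=; lra.
set P := (primes_below N.+1)%:R : R.
have PN := HN0 N NN0; rewrite -/P in PN.
have N1 : 1 <= N%:R :> R by lra.
have P0 : 0 <= P by exact: ler0n.
have lnN : ln N%:R <= l :> R by rewrite lE ler_ln ?posrE //; lra.
have L0 : 0 < L%:R :> R by lra.
have PNl : (1 - e) * N%:R <= P * l by apply: le_trans PN _; exact: ler_wpM2l.
have PD : (1 - 2 * e) * (w * l) <= P - 4 * L%:R - 4.
  have Pz : (1 - e) * (w * l) - 1 <= P.
    rewrite -(ler_pM2r l0); apply: le_trans PNl.
    have h : (1 - e) * (x - 1) <= (1 - e) * N%:R by apply: ler_wpM2l; lra.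
    by apply: le_trans h; rewrite -wl l2l; lra.
  lra.
have lC : l <= (C^-1 + e) * L%:R.
  have h : (C^-1 + e) * (C * l - 1) <= (C^-1 + e) * L%:R by apply: ler_wpM2l; lra.
  apply: le_trans h; have -> : (C^-1 + e) * (C * l - 1) = l + e * C * l - (C^-1 + e).
    by field; rewrite gt_eqF.
  lra.
have lL : l <= 4 * L%:R.
  by have : 1 / 2 * l <= C * l; [rewrite ler_pM2r // ltW | lra].
have Nw : N%:R <= w * l ^+ 2 by rewrite wl.
have := window_optimum e0 e2 l0 w0 L0 lL lC Nw PD
  (fun m => @prime_pairs_windows R N L m LN).
move=> main; rewrite div1r [leRHS]mulrC ler_pdivlMr ?exprn_gt0 //; apply: le_trans main.
rewrite ler_pM2r ?exprn_gt0 // mulrA ler_pM2r //.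
by rewrite -/c; lra.
Unshelve. all: by end_near.
Qed.
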